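(* (i) For a proalgebraic variety $X_\infty=\varprojlim_{\lambda\in\Lambda}\{X_\lambda,\pi_{\lambda\mu}:X_\mu\to X_\lambda\}$ and a projective system $G=\{\gamma_{\lambda\mu}\}$ of non-zero Grothendieck classes $\gamma_{\lambda\mu}\in K_0(\mathcal{V})$, the homomorphisms $\Gamma:F_G^{\mathrm{st}}(X_\lambda)\to K_0(\mathcal{V})$ induce, by passing to inductive limits, the proalgebraic Grothendieck class homomorphism $$\Gamma^{\mathrm{ind}}:F_G^{\mathrm{st.ind}}(X_\infty)\to\varinjlim_{\lambda\in\Lambda}\{\times\gamma_{\lambda\mu}:K_0(\mathcal{V})\to K_0(\mathcal{V})\}.$$ (ii) In the case $\Lambda=\mathbb{N}$, for a proalgebraic variety $X_\infty=\varprojlim_{n\in\mathbb{N}}\{X_n,\pi_{nm}:X_m\to X_n\}$ and a projective system $G=\{\gamma_{nm}\}$ of non-zero Grothendieck classes, there is a canonical (well-defined) proalgebraic Grothendieck class homomorphism $$\widetilde{\Gamma^{\mathrm{ind}}}:F_G^{\mathrm{st.ind}}(X_\infty)\to K_0(\mathcal{V})_G,\qquad \widetilde{\Gamma^{\mathrm{ind}}}([\alpha_n]):=\frac{\Gamma(\alpha_n)}{\gamma_{01}\cdot\gamma_{12}\cdot\gamma_{23}\cdots\gamma_{(n-1)n}}.$$ Here $\gamma_{01}:=1$ is the unit of $K_0(\mathcal{V})$ and $K_0(\mathcal{V})_G$ is the ring of fractions of $K_0(\mathcal{V})$ with respect to the multiplicatively closed set consisting of finite products of powers of elements of $G$. (iii)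 Let $X_\infty=\varprojlim_{n\in\mathbb{N}}\{X_n,\pi_{nm}:X_m\to X_n\}$ be a proalgebraic variety such that for each $n$ there exists $\gamma_n\in K_0(\mathcal{V})$ with $[\pi_{n(n+1)}^{-1}(S_n)]=\gamma_n\cdot[S_n]$ in $K_0(\mathcal{V})$ for every constructible set $S_n\subset X_n$ (for example, $\pi_{n(n+1)}:X_{n+1}\to X_n$ is a Zariski locally trivial fiber bundle with fiber variety $F_n$, in which case $\gamma_n=[F_n]$). Then the canonical proalgebraic Grothendieck class homomorphism $\Gamma^{\mathrm{ind}}:F^{\mathrm{ind}}(X_\infty)\to K_0(\mathcal{V})_G$ is described by $$\Gamma^{\mathrm{ind}}([\alpha_n])=\frac{\Gamma(\alpha_n)}{\gamma_0\cdot\gamma_1\cdot\gamma_2\cdots\gamma_{n-1}}.$$ Here $\gamma_0:=1$ and $K_0(\mathcal{V})_G$ is the ring of fractions of $K_0(\mathcal{V})$ with respect to the multiplicatively closed set consisting of finite products of powers of the $\gamma_m$ ($m=1,2,3,\dots$). (iv) In particular, if in (iii) all the $\gamma_n$ $(n\ge1)$ are equal, say $\gamma_n=\gamma$ for every $n$, then the canonical proalgebraic Grothendieck class homomorphism $\Gamma^{\mathrm{ind}}:F^{\mathrm{ind}}(X_\infty)\to K_0(\mathcal{V})_G$ is described by $$\Gamma^{\mathrm{ind}}([\alpha_n])=\frac{\Gamma(\alpha_n)}{\gamma^{n-1}}.$$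
   Context: $K_0(\mathcal{V})$ is the Grothendieck ring of complex algebraic varieties: the free abelian group on isomorphism classes $[V]$ modulo $[V]=[V']+[V\setminus V']$ for closed subvarieties $V'\subset V$, with product induced by the Cartesian product; a constructible set $S$ has a class $[S]\in K_0(\mathcal{V})$, the sum of the classes of the pieces of any finite partition into locally closed subvarieties. For a complex algebraic variety $X$, $F(X)$ is the abelian group of constructible functions on $X$, i.e. finite $\mathbb{Z}$-linear combinations of characteristic functions $\mathbb{1}_W$ of subvarieties $W\subset X$. For $f:X\to Y$, $f^*:F(Y)\to F(X)$ is $f^*\alpha=\alpha\circ f$. The Grothendieck class homomorphism is $\Gamma:F(X)\to K_0(\mathcal{V})$, $\Gamma(\alpha)=\sum_{n\in\mathbb{Z}}n[\alpha^{-1}(n)]$; equivalently $\Gamma(\sum_W a_W\mathbb{1}_W)=\sum_W a_W[W]$. $\Lambda$ is a directed set and a proalgebraic variety $X_\infty=\varprojlim_{\lambda\in\Lambda}\{X_\lambda,\pi_{\lambda\mu}:X_\mu\to X_\lambda\ (\lambda<\mu)\}$ is the projective limit of a projective system of complex algebraic varieties. $F^{\mathrm{ind}}(X_\infty):=\varinjlim_\lambda\{F(X_\lambda),\pi_{\lambda\mu}^*\}$, and $[\alpha_\lambda]$ denotes the class of $\alpha_\lambda$. A projective system $G=\{\gamma_{\lambda\mu}\}$ in $K_0(\mathcal{V})$ is a family with $\gamma_{\lambda\lambda}=1$ and $\gamma_{\lambda\mu}\gamma_{\mu\nu}=\gamma_{\lambda\nu}$ for $\lambda<\mu<\nu$.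 Put $$F_G^{\mathrm{st}}(X_\lambda):=\{\alpha_\lambda\in F(X_\lambda)\mid\Gamma(\pi_{\lambda\mu}^*\alpha_\lambda)=\gamma_{\lambda\mu}\cdot\Gamma(\alpha_\lambda)\text{ for every }\mu>\lambda\},$$ and $F_G^{\mathrm{st.ind}}(X_\infty):=\varinjlim_\lambda\{F_G^{\mathrm{st}}(X_\lambda),\pi_{\lambda\mu}^*\}$. The limit $\varinjlim_\lambda\{\times\gamma_{\lambda\mu}:K_0(\mathcal{V})\to K_0(\mathcal{V})\}$ has all terms $K_0(\mathcal{V})$ and transition map from index $\lambda$ to index $\mu$ equal to multiplication by $\gamma_{\lambda\mu}$. $\mathbb{N}=\{1,2,3,\dots\}$. ''Canonical'' in (ii)–(iv) means the composite of the homomorphism induced by $\Gamma$ on inductive limits with the homomorphism to the ring of fractions sending the class of $r$ in the $n$-th copy of $K_0(\mathcal{V})$ to $r/(\gamma_{01}\gamma_{12}\cdots\gamma_{(n-1)n})$; in (iii) and (iv) the projective system is $\gamma_{nm}=\gamma_n\gamma_{n+1}\cdots\gamma_{m-1}$ for $n<m$, $\gamma_{nn}=1$, for which $F^{\mathrm{st}}_G(X_n)=F(X_n)$ for all $n$. *)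

(* Defs.v *)
From HB Require Import structures.
From Stdlib Require Rdefinitions.
From mathcomp Require Import all_boot all_order all_algebra.
From mathcomp Require Import boolp classical_sets functions cardinality fsbigop.
From mathcomp Require Import generic_quotient ring_quotient freeg mpoly.
From mathcomp Require Import complex Rstruct ring.

Set Implicit Arguments.
Unset Strict Implicit.
Unset Printing Implicit Defensive.

Import Order.TTheory GRing.Theory.
Local Open Scope classical_set_scope.
Local Open Scope ring_scope.

Section Algebraic.
Variable k : closedFieldType.

(* Points of affine n-space are functions 'I_n -> k, and an algebraic set is
   the zero locus of finitely many polynomials. *)
Definition zeros n (ps : seq {mpoly k[n]}) : set ('I_n -> k) :=
  [set v | forall p, p \in ps -> p.@[v] = 0].

Definition algebraic n (A : set ('I_n -> k)) := exists ps, A = zeros ps.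

Lemma dickson n r (M : set 'X_{1..n}) : exists2 l : seq 'X_{1..n},
  (forall m, m \in l -> M m) &
  forall m, M m -> exists2 m', m' \in l & forall i : 'I_n, (i < r)%N -> (m' i <= m i)%N.
Proof.
elim: r M => [|r IH] M.
  have [[m0 Mm0]|M0] := pselect (exists m, M m).
    by exists [:: m0] => [m|m _]; [rewrite inE => /eqP-> | exists m0; rewrite ?inE].
  by exists [::] => // m Mm; case: M0; exists m.
have [l0 l0M l0P] := IH M.
have [rn|nr] := ltnP r n; last first.
  exists l0 => // m /l0P[m' m'l mP]; exists m' => // i _; apply: mP.
  exact: leq_trans (ltn_ord i) nr.
pose o := Ordinal rn.
pose N := (\max_(m <- l0) m o)%N.
have lP j : {l : seq 'X_{1..n} | (forall m, m \in l -> M m /\ m o = j) /\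
   forall m, M m /\ m o = j ->
     exists2 m', m' \in l & forall i : 'I_n, (i < r)%N -> (m' i <= m i)%N}.
  apply: cid; have [l h1 h2] := IH [set m | M m /\ m o = j].
  by exists l; split.
exists (l0 ++ flatten [seq sval (lP j) | j <- iota 0 N]).
  move=> m; rewrite mem_cat => /orP[/l0M//|/flatten_mapP[j _]].
  by move=> /(proj1 (svalP (lP j)))[].
have oP m m' : (forall i : 'I_n, (i < r)%N -> (m' i <= m i)%N) -> (m' o <= m o)%N ->
  forall i : 'I_n, (i < r.+1)%N -> (m' i <= m i)%N.
  move=> h1 h2 i; rewrite ltnS leq_eqVlt => /orP[/eqP ir|]; last exact: h1.
  by have -> : i = o by exact: val_inj.
move=> m Mm; have [Nm|mN] := leqP N (m o).
  have [m' m'l m'P] := l0P _ Mm.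
  exists m'; first by rewrite mem_cat m'l.
  by apply: oP => //; apply: leq_trans Nm; rewrite /N (big_rem m') //= leq_maxl.
have [m' m'l m'P] := (proj2 (svalP (lP (m o)))) m (conj Mm erefl).
exists m'.
  by rewrite mem_cat; apply/orP; right; apply/flatten_mapP; exists (m o); rewrite ?mem_iota.
by apply: oP => //; have [_ ->] := (proj1 (svalP (lP (m o)))) _ m'l.
Qed.

(* Hilbert's basis theorem, in the form needed here: the zero locus of an
   arbitrary set of polynomials is the zero locus of finitely many of them. *)
Lemma hilbert n (S : set {mpoly k[n]}) : exists2 s : seq {mpoly k[n]},
  (forall p, p \in s -> S p) & forall v p, zeros s v -> S p -> p.@[v] = 0.
Proof.
pose I := [set p : {mpoly k[n]} | exists2 s : seq {mpoly k[n]},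
  (forall q, q \in s -> S q) & forall v, zeros s v -> p.@[v] = 0].
have [l lM lP] := dickson n [set m | exists2 p, I p /\ p != 0 & mlead p = m].
have wP m : {s : seq {mpoly k[n]} | m \in l -> (forall q, q \in s -> S q) /\
  exists2 p, p != 0 /\ mlead p = m & forall v, zeros s v -> p.@[v] = 0}.
  apply: cid; have [ml|nml] := boolP (m \in l); last by exists [::].
  have [p [[s sS sp] p0] <-] := lM _ ml.
  by exists s => _; split => //; exists p.
pose s := flatten [seq sval (wP m) | m <- l].
have sP v m : m \in l -> zeros s v -> zeros (sval (wP m)) v.
  move=> ml sv p pm; apply: sv; apply/flatten_mapP; by exists m.
exists s.
  move=> p /flatten_mapP[m ml pm]; by have [h _] := svalP (wP m) ml; exact: h.
suff IP m : forall p, I p -> p != 0 -> mlead p = m -> forall v, zeros s v -> p.@[v] = 0.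
  move=> v p sv Sp; have [->|p0] := eqVneq p 0; first by rewrite meval0.
  apply: (IP (mlead p)) => //; exists [:: p]; first by move=> q; rewrite inE => /eqP->.
  by move=> w; apply; rewrite inE.
elim/(ltmwf (n := n)): m => m IH p Ip p0 pm v sv.
have [|m' m'l m'P] := lP m; first by exists p.
have [_ [q [q0 qm] qv]] := svalP (wP m') m'l.
have [sS _] := svalP (wP m') m'l.
pose c := mleadc p / mleadc q.
pose t := c *: ('X_[m - m'] * q).
have m'm : (m' <= m)%MM by apply/mnm_lepP => i; exact: m'P.
have q0' : mleadc q != 0 by rewrite mleadc_eq0.
have p0' : mleadc p != 0 by rewrite mleadc_eq0.
have c0 : c != 0 by rewrite mulf_neq0 // invr_eq0.
have X0 : 'X_[m - m'] != 0 :> {mpoly k[n]}.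
  by apply/eqP => /mpolyP/(_ (m - m')%MM); rewrite mcoeffX eqxx mcoeff0 => /eqP; rewrite oner_eq0.
have tm : mlead t = m.
  by rewrite /t mleadZ // mleadM // mleadXm qm submK.
have tc : mleadc t = mleadc p.
  rewrite /t mleadcZE // mleadM // mleadcM mleadXm mcoeffX eqxx mul1r.
  by rewrite /c mulfVK.
have tv w : zeros (sval (wP m')) w -> t.@[w] = 0.
  by move=> /qv h; rewrite /t mevalZ mevalM h !mulr0.
suff : (p - t).@[v] = 0.
  by rewrite mevalB tv ?subr0 //; exact: sP.
have [->|r0] := eqVneq (p - t) 0; first by rewrite meval0.
apply: (IH (mlead (p - t))) => //.
  have le : (mlead (p - t) <= m)%O.
    by apply: le_trans (mleadB_le _ _) _; rewrite pm tm joinxx.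
  rewrite lt_neqAle le andbT; apply/eqP => e.
  move: r0; rewrite -mleadc_eq0 e mcoeffB.
  have -> : t@_m = mleadc p by rewrite -tc tm.
  by rewrite -pm subrr eqxx.
have [s1 s1S s1p] := Ip.
exists (s1 ++ sval (wP m')).
  by move=> r; rewrite mem_cat => /orP[/s1S//|/sS].
move=> w hw; rewrite mevalB s1p ?tv ?subr0 // => r rs; apply: hw; rewrite mem_cat rs //.
by rewrite orbT.
Qed.

Lemma algebraicP n (A : set ('I_n -> k)) :
  algebraic A <-> forall v, ~ A v -> exists2 p : {mpoly k[n]},
    (forall w, A w -> p.@[w] = 0) & p.@[v] != 0.
Proof.
split=> [[ps ->] v /existsNP[p /not_implyP[pps /eqP pv]]|h].
  by exists p => // w; apply.
have [s sS sP] := hilbert [set p : {mpoly k[n]} | forall w, A w -> p.@[w] = 0].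
exists s; apply/seteqP; split=> v.
  by move=> Av p /sS; exact.
move=> sv; apply: contrapT => /h[p pA]; rewrite (sP v p) ?eqxx //.
Qed.

Definition polyfun n (f : ('I_n -> k) -> k) := exists p : {mpoly k[n]}, forall v, f v = p.@[v].
Definition polymap n m (f : ('I_n -> k) -> ('I_m -> k)) := forall i, polyfun (fun v => f v i).

Lemma polyfun_crd n i : polyfun (fun v : 'I_n -> k => v i).
Proof. by exists 'X_i => v; rewrite mevalXU. Qed.
Lemma polyfunC n c : polyfun (fun _ : 'I_n -> k => c).
Proof. by exists c%:MP => v; rewrite mevalC. Qed.
Lemma polyfunB n (f g : ('I_n -> k) -> k) :
  polyfun f -> polyfun g -> polyfun (fun v => f v - g v).
Proof. by move=> [p pE] [q qE]; exists (p - q) => v; rewrite mevalB pE qE. Qed.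
Lemma polyfunM n (f g : ('I_n -> k) -> k) :
  polyfun f -> polyfun g -> polyfun (fun v => f v * g v).
Proof. by move=> [p pE] [q qE]; exists (p * q) => v; rewrite mevalM pE qE. Qed.
Lemma polyfun_mpoly n m (f : ('I_n -> k) -> ('I_m -> k)) (p : {mpoly k[m]}) :
  polymap f -> polyfun (fun v => p.@[f v]).
Proof.
move=> fP; pose q i := projT1 (cid (fP i)).
exists (p \mPo [tuple q i | i < m]) => v; rewrite comp_mpoly_meval.
apply: meval_eq => i; rewrite tnth_mktuple /q.
by case: cid.
Qed.

Lemma algebraic_preim n m (f : ('I_n -> k) -> ('I_m -> k)) A :
  polymap f -> algebraic A -> algebraic (f @^-1` A).
Proof.
move=> fP /algebraicP AP; apply/algebraicP => v /AP[p pA pv].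
have [q qE] := polyfun_mpoly p fP.
by exists q; [move=> w Aw; rewrite -qE; exact: pA | rewrite -qE].
Qed.

Lemma algebraicI n (A B : set ('I_n -> k)) : algebraic A -> algebraic B -> algebraic (A `&` B).
Proof.
move=> /algebraicP AP /algebraicP BP; apply/algebraicP => v /not_andP[/AP|/BP] [p pA pv].
  by exists p => // w [/pA].
by exists p => // w [_ /pA].
Qed.

Lemma algebraic_eq0 n (f : ('I_n -> k) -> k) : polyfun f -> algebraic [set v | f v = 0].
Proof.
move=> [p pE]; exists [:: p]; apply/seteqP; split => v /=.
  by move=> fv q; rewrite inE => /eqP->; rewrite -pE.
by move=> h; rewrite pE; apply: h; rewrite inE.
Qed.

Definition vpair n m (u : 'I_n -> k) (v : 'I_m -> k) : 'I_(n + m) -> k :=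
  fun i => match fintype.split i with inl a => u a | inr b => v b end.
Definition vfst n m (w : 'I_(n + m) -> k) : 'I_n -> k := fun i => w (lshift m i).
Definition vsnd n m (w : 'I_(n + m) -> k) : 'I_m -> k := fun i => w (rshift n i).

Lemma vpair_l n m (u : 'I_n -> k) (v : 'I_m -> k) i : vpair u v (lshift m i) = u i.
Proof. by rewrite /vpair (unsplitK (inl i)). Qed.
Lemma vpair_r n m (u : 'I_n -> k) (v : 'I_m -> k) i : vpair u v (rshift n i) = v i.
Proof. by rewrite /vpair (unsplitK (inr i)). Qed.
Lemma vfstK n m (u : 'I_n -> k) (v : 'I_m -> k) : vfst (vpair u v) = u.
Proof. by apply/funext => i; rewrite /vfst vpair_l. Qed.
Lemma vsndK n m (u : 'I_n -> k) (v : 'I_m -> k) : vsnd (vpair u v) = v.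
Proof. by apply/funext => i; rewrite /vsnd vpair_r. Qed.
Lemma vpairK n m (w : 'I_(n + m) -> k) : vpair (vfst w) (vsnd w) = w.
Proof. by apply/funext => i; rewrite /vpair; case: splitP => j ij; rewrite /vfst/vsnd; congr w; exact: val_inj. Qed.
Lemma polymap_fst n m : polymap (@vfst n m).
Proof. by move=> i; exact: polyfun_crd. Qed.
Lemma polymap_snd n m : polymap (@vsnd n m).
Proof. by move=> i; exact: polyfun_crd. Qed.
Lemma polymap_comp n m p (f : ('I_n -> k) -> ('I_m -> k)) (g : ('I_m -> k) -> ('I_p -> k)) :
  polymap f -> polymap g -> polymap (g \o f).
Proof.
move=> fP gP i; have [q qE] := gP i; have [r rE] := polyfun_mpoly q fP.
by exists r => v /=; rewrite qE rE.
Qed.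
Lemma polymap_pair n m p (f : ('I_n -> k) -> ('I_m -> k)) (g : ('I_n -> k) -> ('I_p -> k)) :
  polymap f -> polymap g -> polymap (fun v => vpair (f v) (g v)).
Proof.
by move=> fP gP i; rewrite /vpair; case: (fintype.split i) => j.
Qed.

End Algebraic.

Section Varieties.
Variable k : closedFieldType.

(* A variety is described in the style of Weil and Serre: a set of points with
   finitely many charts, each a bijection from a subset cdom onto an algebraic
   subset of an affine space. On overlaps, which are open, coordinates of one
   chart are regular functions in the other, i.e. locally quotients of
   polynomials. *)
Record chart (X : Type) := Chart {
  cdim : nat;
  cdom : set X;
  ccrd : X -> 'I_cdim -> k }.
Arguments ccrd {X} c x i.

Definition affine_chart X (c : chart X) :=
  (forall x y, cdom c x -> cdom c y -> ccrd c x = ccrd c y -> x = y) /\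
  algebraic (ccrd c @` cdom c).

(* P contains a basic open neighbourhood {h <> 0} of x in the chart c. *)
Definition cnear X (c : chart X) (x : X) (P : set X) :=
  exists2 h : {mpoly k[cdim c]}, h.@[ccrd c x] != 0 &
    forall y, cdom c y -> h.@[ccrd c y] != 0 -> P y.

Definition cregular X (c : chart X) (x : X) (f : X -> k) :=
  exists g h : {mpoly k[cdim c]}, h.@[ccrd c x] != 0 /\
    forall y, cdom c y -> h.@[ccrd c y] != 0 -> f y = g.@[ccrd c y] / h.@[ccrd c y].

(* atlas_compat says that each overlap is open in both charts and that the
   transition maps are regular. atlas_separated says that the diagonal of X x X
   is closed: the displayed set is the part of it in the product of the charts
   c and c', which is closed in affine space of dimension cdim c + cdim c'. *)
Record variety := Variety {
  points :> Type;
  atlas : set (chart points);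
  atlas_finite : finite_set atlas;
  atlas_cover : forall x, exists2 c, atlas c & cdom c x;
  atlas_affine : forall c, atlas c -> affine_chart c;
  atlas_compat : forall c c', atlas c -> atlas c' ->
    forall x, cdom c x -> cdom c' x ->
      cnear c x (cdom c') /\ forall i, cregular c x (fun y => ccrd c' y i);
  atlas_separated : forall c c', atlas c -> atlas c' ->
    algebraic [set vpair (ccrd c x) (ccrd c' x) | x in cdom c `&` cdom c'] }.

Section Chart.
Variables (X : Type) (c : chart X) (x : X).

Lemma cnearT P : (forall y, P y) -> cnear c x P.
Proof. by move=> h; exists 1 => //; rewrite meval1 oner_eq0. Qed.

Lemma cnear_dom : cnear c x (cdom c).
Proof. by exists 1 => //; rewrite meval1 oner_eq0. Qed.

Lemma cnearS (P Q : set X) : (forall y, cdom c y -> P y -> Q y) -> cnear c x P -> cnear c x Q.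
Proof. by move=> PQ [h hx hP]; exists h => // y cy hy; apply: PQ => //; exact: hP. Qed.

Lemma cnearI (P Q : set X) : cnear c x P -> cnear c x Q -> cnear c x (P `&` Q).
Proof.
move=> [h hx hP] [g gx gQ]; exists (h * g); first by rewrite mevalM mulf_neq0.
by move=> y cy; rewrite mevalM mulf_eq0 negb_or => /andP[/hP ? /gQ ?]; split; auto.
Qed.

Lemma cnear_pt P : cdom c x -> cnear c x P -> P x.
Proof. by move=> cx [h hx]; apply. Qed.

Lemma cregular_eq f g : cnear c x (fun y => f y = g y) -> cregular c x f -> cregular c x g.
Proof.
move=> [h hx hfg] [a [b [bx fE]]]; exists (a * h), (b * h); split.
  by rewrite mevalM mulf_neq0.
move=> y cy; rewrite !mevalM mulf_eq0 negb_or => /andP[by0 hy].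
by rewrite -hfg // fE // -mulf_div divff // mulr1.
Qed.

Lemma cregularC a : cregular c x (fun=> a).
Proof. by exists a%:MP, 1; rewrite meval1 oner_eq0; split => // y _ _; rewrite mevalC meval1 divr1. Qed.

Lemma cregular_poly (p : {mpoly k[cdim c]}) : cregular c x (fun y => p.@[ccrd c y]).
Proof. by exists p, 1; rewrite meval1 oner_eq0; split => // y _ _; rewrite meval1 divr1. Qed.

Lemma cregularD f g : cregular c x f -> cregular c x g -> cregular c x (fun y => f y + g y).
Proof.
move=> [a [b [bx fE]]] [a' [b' [b'x gE]]]; exists (a * b' + a' * b), (b * b').
split; first by rewrite mevalM mulf_neq0.
move=> y cy; rewrite mevalD !mevalM mulf_eq0 negb_or => /andP[y1 y2].
by rewrite fE // gE // addf_div.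
Qed.

Lemma cregularM f g : cregular c x f -> cregular c x g -> cregular c x (fun y => f y * g y).
Proof.
move=> [a [b [bx fE]]] [a' [b' [b'x gE]]]; exists (a * a'), (b * b').
split; first by rewrite mevalM mulf_neq0.
move=> y cy; rewrite !mevalM mulf_eq0 negb_or => /andP[y1 y2].
by rewrite fE // gE // mulf_div.
Qed.

Lemma cregular_neq0 f : cdom c x -> cregular c x f -> f x != 0 ->
  cnear c x (fun y => f y != 0).
Proof.
move=> cx [a [b [bx fE]]]; rewrite fE // mulf_eq0 negb_or => /andP[ax _].
exists (a * b); first by rewrite mevalM mulf_neq0.
move=> y cy; rewrite mevalM mulf_eq0 negb_or => /andP[y1 y2].
by rewrite fE // mulf_neq0 // invr_eq0.
Qed.

Lemma cregularV f : cdom c x -> cregular c x f -> f x != 0 ->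
  cregular c x (fun y => (f y)^-1).
Proof.
move=> cx [a [b [bx fE]]] fx; exists (b * b), (a * b); split.
  by move: fx; rewrite mevalM fE // mulf_eq0 negb_or => /andP[? _]; rewrite mulf_neq0.
move=> y cy; rewrite !mevalM mulf_eq0 negb_or => /andP[y1 y2].
by rewrite fE // invf_div -mulf_div divff // mulr1.
Qed.

Lemma cregular_mpoly n (F : X -> 'I_n -> k) (p : {mpoly k[n]}) :
  (forall i, cregular c x (fun y => F y i)) -> cregular c x (fun y => p.@[F y]).
Proof.
move=> FP; have prodP (m : 'X_{1..n}) (r : seq 'I_n) :
    cregular c x (fun y => \prod_(i <- r) F y i ^+ m i).
  elim: r => [|i r IH].
    by apply: cregular_eq (cregularC 1); apply: cnearT => y; rewrite big_nil.
  suff h j : cregular c x (fun y => F y i ^+ j).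
    apply: cregular_eq (cregularM (h (m i)) IH); apply: cnearT => y.
    by rewrite big_cons.
  elim: j => [|j IHj]; first by apply: cregular_eq (cregularC 1); exact: cnearT.
  by apply: cregular_eq (cregularM (FP i) IHj); apply: cnearT => y; rewrite exprS.
have sumP (r : seq 'X_{1..n}) :
    cregular c x (fun y => \sum_(m <- r) p@_m * \prod_i F y i ^+ m i).
  elim: r => [|m r IH].
    by apply: cregular_eq (cregularC 0); apply: cnearT => y; rewrite big_nil.
  apply: cregular_eq (cregularD (cregularM (cregularC p@_m) (prodP m _)) IH).
  by apply: cnearT => y; rewrite big_cons.
apply: cregular_eq (sumP (msupp p)); apply: cnearT => y.
by rewrite mevalE.
Qed.

End Chart.

Lemma cnear_pull X Y (c : chart X) (d : chart Y) (f : X -> Y) F x P :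
  polymap F -> (forall y, ccrd d (f y) = F (ccrd c y)) ->
  (forall y, cdom c y -> cdom d (f y)) ->
  cnear d (f x) P -> cnear c x (fun y => P (f y)).
Proof.
move=> Fp fF fd [h hx hP]; have [q qE] := polyfun_mpoly h Fp.
exists q; first by rewrite -qE -fF.
by move=> y cy; rewrite -qE -fF; apply: hP; exact: fd.
Qed.

Lemma cregular_pull X Y (c : chart X) (d : chart Y) (f : X -> Y) F x phi :
  polymap F -> (forall y, ccrd d (f y) = F (ccrd c y)) ->
  (forall y, cdom c y -> cdom d (f y)) ->
  cregular d (f x) phi -> cregular c x (fun y => phi (f y)).
Proof.
move=> Fp fF fd [g [h [hx hP]]].
have [q qE] := polyfun_mpoly h Fp; have [r rE] := polyfun_mpoly g Fp.
exists r, q; split; first by rewrite -qE -fF.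
by move=> y cy; rewrite -qE -rE -fF; apply: hP; exact: fd.
Qed.

Section VarTop.
Variable X : variety.

Definition vnear (x : X) (P : set X) :=
  exists c, [/\ atlas c, cdom c x & cnear c x P].

Definition regular_at (x : X) (f : X -> k) :=
  exists c, [/\ atlas c, cdom c x & cregular c x f].

Definition closed (Z : set X) :=
  forall c : chart X, atlas c -> algebraic (ccrd c @` (cdom c `&` Z)).

Lemma cnear_chg (c c' : chart X) x P : atlas c -> atlas c' -> cdom c x -> cdom c' x ->
  cnear c' x P -> cnear c x P.
Proof.
move=> ac ac' cx c'x [h hx hP].
have [n1 r1] := atlas_compat ac ac' cx c'x.
have := cnearI n1 (cregular_neq0 cx (cregular_mpoly h r1) hx).
by apply: cnearS => y _ [] /hP.
Qed.

Lemma cregular_chg (c c' : chart X) x f : atlas c -> atlas c' -> cdom c x -> cdom c' x ->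
  cregular c' x f -> cregular c x f.
Proof.
move=> ac ac' cx c'x [g [h [hx hP]]].
have [n1 r1] := atlas_compat ac ac' cx c'x.
have hr := cregular_mpoly h r1; have gr := cregular_mpoly g r1.
apply: cregular_eq (cregularM gr (cregularV cx hr hx)).
have := cnearI n1 (cregular_neq0 cx hr hx).
by apply: cnearS => y _ [y1 y2]; rewrite hP.
Qed.

Lemma vnearP (c : chart X) x P : atlas c -> cdom c x -> vnear x P <-> cnear c x P.
Proof.
move=> ac cx; split=> [[c' [ac' c'x]]|]; first exact: cnear_chg.
by exists c.
Qed.

Lemma regularP (c : chart X) x f : atlas c -> cdom c x -> regular_at x f <-> cregular c x f.
Proof.
move=> ac cx; split=> [[c' [ac' c'x]]|]; first exact: cregular_chg.
by exists c.
Qed.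

Lemma vnearS x (P Q : set X) : (forall y, P y -> Q y) -> vnear x P -> vnear x Q.
Proof. by move=> PQ [c [? ? h]]; exists c; split => //; apply: cnearS h => y _; exact: PQ. Qed.

Lemma vnearI x (P Q : set X) : vnear x P -> vnear x Q -> vnear x (P `&` Q).
Proof.
have [c ac cx] := atlas_cover x.
by move=> /(vnearP _ ac cx) nP /(vnearP _ ac cx) nQ; apply/(vnearP _ ac cx); exact: cnearI.
Qed.

Lemma vnear_pt x P : vnear x P -> P x.
Proof. by move=> [c [_ cx]]; exact: cnear_pt. Qed.

Lemma vnearT x P : (forall y, P y) -> vnear x P.
Proof. by move=> h; have [c ac cx] := atlas_cover x; exists c; split => //; exact: cnearT. Qed.

Lemma vnear_dom (c : chart X) x : atlas c -> cdom c x -> vnear x (cdom c).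
Proof. by move=> ac cx; exists c; split => //; exact: cnear_dom. Qed.

Lemma regular_eq x f g : vnear x (fun y => f y = g y) -> regular_at x f -> regular_at x g.
Proof.
have [c ac cx] := atlas_cover x.
by move=> /(vnearP _ ac cx) n /(regularP _ ac cx) r; apply/(regularP _ ac cx); exact: cregular_eq n r.
Qed.

Lemma regular_mpoly x n (F : X -> 'I_n -> k) (p : {mpoly k[n]}) :
  (forall i, regular_at x (fun y => F y i)) -> regular_at x (fun y => p.@[F y]).
Proof.
have [c ac cx] := atlas_cover x => FP.
by apply/(regularP _ ac cx)/cregular_mpoly => i; exact/(regularP _ ac cx).
Qed.

Lemma regularM x f g : regular_at x f -> regular_at x g -> regular_at x (fun y => f y * g y).
Proof.
have [c ac cx] := atlas_cover x.
by move=> /(regularP _ ac cx) rf /(regularP _ ac cx) rg; apply/(regularP _ ac cx); exact: cregularM.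
Qed.

Lemma regularV x f : regular_at x f -> f x != 0 -> regular_at x (fun y => (f y)^-1).
Proof.
have [c ac cx] := atlas_cover x.
by move=> /(regularP _ ac cx) rf fx; apply/(regularP _ ac cx); exact: cregularV.
Qed.

Lemma regular_neq0 x f : regular_at x f -> f x != 0 -> vnear x (fun y => f y != 0).
Proof.
have [c ac cx] := atlas_cover x.
by move=> /(regularP _ ac cx) rf fx; apply/(vnearP _ ac cx); exact: cregular_neq0.
Qed.

Lemma regular_crd (c : chart X) x i : atlas c -> cdom c x -> regular_at x (fun y => ccrd c y i).
Proof.
move=> ac cx; apply/(regularP _ ac cx).
refine (cregular_eq _ (@cregular_poly _ c x 'X_i)); apply: cnearT => y.
by rewrite mevalXU.
Qed.

(* A set is closed as soon as its complement is a neighbourhood of each of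
   its points; this is where noetherianity is used. *)
Lemma closedP (Z : set X) : closed Z <-> forall x, ~ Z x -> vnear x (~` Z).
Proof.
split=> [Zc x Zx|h c ac].
  have [c ac cx] := atlas_cover x; apply/(vnearP _ ac cx).
  have /algebraicP/(_ (ccrd c x))[] := Zc _ ac.
    move=> [y [cy Zy] yx]; apply: Zx; rewrite -(proj1 (atlas_affine ac) _ _ cy cx yx) //.
  move=> p pZ px; exists p => // y cy py Zy; move: py; rewrite pZ ?eqxx //.
  by exists y.
have [cinj calg] := atlas_affine ac.
apply/algebraicP => v nv; have [[x cx xv]|nx] := pselect ((ccrd c @` cdom c) v); last first.
  move/algebraicP : calg => /(_ v nx)[p pP pv]; exists p => // w [y [cy _] yw].
  by apply: pP; exists y.
have Zx : ~ Z x by move=> Zx; apply: nv; exists x.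
have /(vnearP _ ac cx)[p px pP] := h x Zx.
exists p; last by rewrite -xv.
move=> w [y [cy Zy] <-]; apply/eqP; apply: contrapT => /negP.
by move=> /(pP _ cy); apply.
Qed.

Lemma closedI A B : closed A -> closed B -> closed (A `&` B).
Proof.
move=> /closedP Ac /closedP Bc; apply/closedP => x /not_andP[/Ac|/Bc];
  by apply: vnearS => y ny [] *; apply: ny.
Qed.

Lemma closedU A B : closed A -> closed B -> closed (A `|` B).
Proof.
move=> /closedP Ac /closedP Bc; apply/closedP => x /not_orP[/Ac xA /Bc xB].
by have := vnearI xA xB; apply: vnearS => y [? ?] [].
Qed.

Lemma closedT : closed setT. Proof. by apply/closedP => x []. Qed.
Lemma closed0 : closed set0. Proof. by apply/closedP => x _; apply: vnearT => y []. Qed.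

Definition locally_closed (S : set X) :=
  exists A B, [/\ closed A, closed B & S = A `\` B].

Lemma locally_closed_closed A : closed A -> locally_closed A.
Proof. by move=> Ac; exists A, set0; rewrite setD0; split => //; exact: closed0. Qed.

Lemma locally_closedC A : closed A -> locally_closed (~` A).
Proof. by move=> Ac; exists setT, A; rewrite setTD; split => //; exact: closedT. Qed.

Lemma locally_closedI S T : locally_closed S -> locally_closed T -> locally_closed (S `&` T).
Proof.
move=> [A [B [Ac Bc ->]]] [A' [B' [Ac' Bc' ->]]].
exists (A `&` A'), (B `|` B'); split; [exact: closedI|exact: closedU|].
by rewrite !setDE setCU setIACA.
Qed.

End VarTop.

Arguments closed {X}.
Arguments locally_closed {X}.
Arguments regular_at {X}.
Arguments vnear {X}.

(* Continuous maps that pull regular functions back to regular functions. *)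
Definition morphism (X Y : variety) (f : X -> Y) :=
  (forall Z, closed Z -> closed (f @^-1` Z)) /\
  (forall x phi, regular_at (f x) phi -> regular_at x (phi \o f)).

Record hom (X Y : variety) := Hom { hfun :> X -> Y; homP : morphism hfun }.

Lemma morphism_germ (X Y : variety) (f : X -> Y) :
  (forall x phi, regular_at (f x) phi -> regular_at x (phi \o f)) -> morphism f.
Proof.
move=> h; split => // Z Zc; apply/closedP => x Zx.
pose phi (y : Y) : k := if `[< Z y >] then 0 else 1.
have phi1 y : ~ Z y -> phi y = 1 by move=> Zy; rewrite /phi asboolF.
have phi0 y : Z y -> phi y = 0 by move=> Zy; rewrite /phi asboolT.
have phir : regular_at (f x) phi.
  have [c ac cx] := atlas_cover (f x).
  apply: (regular_eq (f := fun=> 1)); last by exists c; split => //; exact: cregularC.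
  by have /closedP/(_ _ Zx) := Zc; apply: vnearS => y /phi1.
have /(regular_neq0 (h _ _ phir)) : phi (f x) != 0 by rewrite phi1 ?oner_eq0.
by apply: vnearS => y /eqP py /phi0.
Qed.

Lemma hom_regular (X Y : variety) (f : hom X Y) x phi :
  regular_at (f x) phi -> regular_at x (fun y => phi (f y)).
Proof. exact: (proj2 (homP f)). Qed.

Lemma hom_closed (X Y : variety) (f : hom X Y) Z : closed Z -> closed (f @^-1` Z).
Proof. exact: (proj1 (homP f)). Qed.

Lemma hom_near (X Y : variety) (f : hom X Y) x P : vnear (f x) P -> vnear x (f @^-1` P).
Proof.
move=> fP; have [c ac cx] := atlas_cover (f x).
move/(vnearP _ ac cx): fP => [h hx hP].
have hr : regular_at x (fun y => h.@[ccrd c (f y)]).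
  apply: (hom_regular (phi := fun y => h.@[ccrd c y])).
  by apply/(regularP _ ac cx); exact: cregular_poly.
have := regular_neq0 hr hx.
suff : vnear x (f @^-1` (cdom c)).
  by move=> h1 h2; have := vnearI h1 h2; apply: vnearS => y [] /hP.
have : closed (~` (cdom c)).
  apply/closedP => y; rewrite setCK => /contrapT cy.
  exact: vnear_dom.
move=> /(hom_closed f)/closedP /(_ x); rewrite /preimage /=.
have -> : ~` [set t | (~` cdom c) (f t)] = [set t | cdom c (f t)].
  by apply/seteqP; split => y /= ; [move/contrapT|move=> ?; apply].
by apply.
Qed.

Lemma morphism_chart (X Y : variety) (f : X -> Y) :
  (forall x, exists c : chart Y, [/\ atlas c, cdom c (f x), vnear x (f @^-1` cdom c) &
     forall i, regular_at x (fun y => ccrd c (f y) i)]) -> morphism f.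
Proof.
move=> h; apply: morphism_germ => x phi; have [c [ac cx xc xr]] := h x.
move=> /(regularP _ ac cx)[p [q [qx phiE]]].
have pr := regular_mpoly p xr; have qr := regular_mpoly q xr.
apply: regular_eq (regularM pr (regularV qr qx)).
have := vnearI xc (regular_neq0 qr qx); apply: vnearS => y [? ?].
by rewrite /= phiE.
Qed.

Definition hom_id X : hom X X.
Proof. by exists id; apply: morphism_germ. Defined.

Definition hom_comp X Y Z (g : hom Y Z) (f : hom X Y) : hom X Z.
Proof.
by exists (g \o f); split => [S /(hom_closed g)/(hom_closed f)//|x phi /(hom_regular (f := g))/(hom_regular (f:=f))].
Defined.

Definition iso (X Y : variety) :=
  exists (f : hom X Y) (g : hom Y X), cancel f g /\ cancel g f.

Lemma iso_sym X Y : iso X Y -> iso Y X.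
Proof. by move=> [f [g [fg gf]]]; exists g, f. Qed.

Section Product.
Variables X Y : variety.

Definition prod_chart (c : chart X) (d : chart Y) : chart (X * Y) :=
  @Chart (X * Y) (cdim c + cdim d) [set p | cdom c p.1 /\ cdom d p.2]
    (fun p => vpair (ccrd c p.1) (ccrd d p.2)).

Definition prod_atlas : set (chart (X * Y)) :=
  [set prod_chart cd.1 cd.2 | cd in (@atlas X) `*` (@atlas Y)].

Lemma prod_near_fst c d (p : X * Y) P : cnear c p.1 P -> cnear (prod_chart c d) p (fun q => P q.1).
Proof.
refine (@cnear_pull _ _ (prod_chart c d) c fst _ p P (@polymap_fst k _ (cdim d)) _ _).
- by move=> y; rewrite /= vfstK.
- by move=> y [].
Qed.
Lemma prod_near_snd c d (p : X * Y) P : cnear d p.2 P -> cnear (prod_chart c d) p (fun q => P q.2).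
Proof.
refine (@cnear_pull _ _ (prod_chart c d) d snd _ p P (@polymap_snd k (cdim c) _) _ _).
- by move=> y; rewrite /= vsndK.
- by move=> y [].
Qed.
Lemma prod_regular_fst c d (p : X * Y) P :
  cregular c p.1 P -> cregular (prod_chart c d) p (fun q => P q.1).
Proof.
refine (@cregular_pull _ _ (prod_chart c d) c fst _ p P (@polymap_fst k _ (cdim d)) _ _).
- by move=> y; rewrite /= vfstK.
- by move=> y [].
Qed.
Lemma prod_regular_snd c d (p : X * Y) P :
  cregular d p.2 P -> cregular (prod_chart c d) p (fun q => P q.2).
Proof.
refine (@cregular_pull _ _ (prod_chart c d) d snd _ p P (@polymap_snd k (cdim c) _) _ _).
- by move=> y; rewrite /= vsndK.
- by move=> y [].
Qed.

Lemma prod_atlas_finite : finite_set prod_atlas.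
Proof. by apply: finite_image; apply: finite_setX; exact: atlas_finite. Qed.

Lemma prod_atlas_cover x : exists2 c, prod_atlas c & cdom c x.
Proof.
have [c ac cx] := atlas_cover x.1; have [d ad dx] := atlas_cover x.2.
by exists (prod_chart c d) => //; exists (c, d).
Qed.

Lemma prod_atlas_affine c : prod_atlas c -> affine_chart c.
Proof.
move=> [[{}c d] /= [ac ad] <-]; split.
  move=> [x y] [x' y'] /= [cx dy] [cx' dy'] e.
  have e1 : ccrd c x = ccrd c x' by rewrite -(vfstK (ccrd c x) (ccrd d y)) e vfstK.
  have e2 : ccrd d y = ccrd d y' by rewrite -(vsndK (ccrd c x) (ccrd d y)) e vsndK.
  by rewrite ((proj1 (atlas_affine ac)) _ _ cx cx' e1) ((proj1 (atlas_affine ad)) _ _ dy dy' e2).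
have := algebraicI (algebraic_preim (@polymap_fst _ _ _) (proj2 (atlas_affine ac)))
                   (algebraic_preim (@polymap_snd _ _ _) (proj2 (atlas_affine ad))).
congr algebraic; apply/seteqP; split => w.
  by move=> [[x cx wx] [y dy wy]]; exists (x, y) => //=; rewrite wx wy vpairK.
by move=> [[x y] /= [cx cy] <-]; split; rewrite /preimage /= ?vfstK ?vsndK; [exists x|exists y].
Qed.

Lemma prod_atlas_compat c c' : prod_atlas c -> prod_atlas c' ->
    forall x, cdom c x -> cdom c' x ->
      cnear c x (cdom c') /\ forall i, cregular c x (fun y => ccrd c' y i).
Proof.
move=> [[{}c d] /= [ac ad] <-] [[{}c' d'] /= [ac' ad'] <-] x [cx dx] [c'x d'x].
have [n1 r1] := atlas_compat ac ac' cx c'x.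
have [n2 r2] := atlas_compat ad ad' dx d'x.
split; first exact: cnearI (prod_near_fst _ n1) (prod_near_snd _ n2).
move=> i /=; rewrite /vpair; case: (fintype.split i) => j.
  exact: (prod_regular_fst _ (r1 j)).
exact: (prod_regular_snd _ (r2 j)).
Qed.

Lemma prod_atlas_separated c c' : prod_atlas c -> prod_atlas c' ->
    algebraic [set vpair (ccrd c x) (ccrd c' x) | x in cdom c `&` cdom c'].
Proof.
move=> [[{}c d] /= [ac ad] <-] [[{}c' d'] /= [ac' ad'] <-].
have P1 : @polymap k ((cdim c + cdim d) + (cdim c' + cdim d')) _
   (fun w => vpair (vfst (vfst w)) (vfst (vsnd w))).
  apply: polymap_pair; apply: (@polymap_comp k _ _ _ (@vfst k _ _) (@vfst k _ _))
   || apply: (@polymap_comp k _ _ _ (@vsnd k _ _) (@vfst k _ _));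
  by [exact: polymap_fst|exact: polymap_snd].
have P2 : @polymap k ((cdim c + cdim d) + (cdim c' + cdim d')) _
   (fun w => vpair (vsnd (vfst w)) (vsnd (vsnd w))).
  apply: polymap_pair; apply: (@polymap_comp k _ _ _ (@vfst k _ _) (@vsnd k _ _))
   || apply: (@polymap_comp k _ _ _ (@vsnd k _ _) (@vsnd k _ _));
  by [exact: polymap_fst|exact: polymap_snd].
have := algebraicI (algebraic_preim P1 (atlas_separated ac ac'))
                   (algebraic_preim P2 (atlas_separated ad ad')).
congr algebraic; apply/seteqP; split => w.
  move=> [[x [cx c'x] wx] [y [dy d'y] wy]]; exists (x, y) => //=.
  rewrite -[RHS]vpairK -[in RHS](vpairK (vfst w)) -[in RHS](vpairK (vsnd w)).
  congr (vpair (vpair _ _) (vpair _ _)).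
  - by rewrite -(vfstK (ccrd c x) (ccrd c' x)) wx vfstK.
  - by rewrite -(vfstK (ccrd d y) (ccrd d' y)) wy vfstK.
  - by rewrite -(vsndK (ccrd c x) (ccrd c' x)) wx vsndK.
  - by rewrite -(vsndK (ccrd d y) (ccrd d' y)) wy vsndK.
move=> [[x y] /= [[cx dy] [c'x d'y]] <-]; split; rewrite /preimage /=.
  by exists x => //; rewrite !(vfstK, vsndK).
by exists y => //; rewrite !(vfstK, vsndK).
Qed.

Definition prod_variety : variety :=
  Variety prod_atlas_finite prod_atlas_cover prod_atlas_affine
    prod_atlas_compat prod_atlas_separated.

Lemma hom_fst_morph : @morphism prod_variety X fst.
Proof.
apply: morphism_germ => p phi; have [c ac cx] := atlas_cover p.1.
move=> /(regularP _ ac cx) r; have [d ad dx] := atlas_cover p.2.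
exists (prod_chart c d); split => //; first by exists (c, d).
exact: prod_regular_fst.
Qed.
Lemma hom_snd_morph : @morphism prod_variety Y snd.
Proof.
apply: morphism_germ => p phi; have [c ac cx] := atlas_cover p.2.
move=> /(regularP _ ac cx) r; have [d ad dx] := atlas_cover p.1.
exists (prod_chart d c); split => //; first by exists (d, c).
exact: prod_regular_snd.
Qed.
Definition hom_fst := Hom hom_fst_morph.
Definition hom_snd := Hom hom_snd_morph.

Lemma hom_pair_morph (T : variety) (f : hom T X) (g : hom T Y) :
  @morphism T prod_variety (fun t => (f t, g t)).
Proof.
apply: morphism_chart => t.
have [c ac cx] := atlas_cover (f t); have [d ad dx] := atlas_cover (g t).
exists (prod_chart c d); split => //; first by exists (c, d).
  apply: vnearI; [have := hom_near (vnear_dom ac cx) | have := hom_near (vnear_dom ad dx)];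
  exact.
move=> i; rewrite /= /vpair; case: (fintype.split i) => j.
  exact: (hom_regular (phi := fun y => ccrd c y j)) (regular_crd _ ac cx).
exact: (hom_regular (phi := fun y => ccrd d y j)) (regular_crd _ ad dx).
Qed.
Definition hom_pair (T : variety) (f : hom T X) (g : hom T Y) := Hom (hom_pair_morph f g).

End Product.

Definition pt_chart : chart unit := @Chart unit 0 setT (fun _ _ => 0).

Lemma algebraic_setT n (A : set ('I_n -> k)) : A = setT -> algebraic A.
Proof. by move=> ->; apply/algebraicP => v; case. Qed.

Lemma vec0_eq (u v : 'I_0 -> k) : u = v.
Proof. by apply/funext; case. Qed.

Lemma pt_atlas_cover (x : unit) : exists2 c, [set pt_chart] c & cdom c x.
Proof. by exists pt_chart. Qed.

Lemma pt_atlas_affine c : [set pt_chart] c -> affine_chart c.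
Proof.
move=> ->; split=> [[] []//|]; apply: algebraic_setT.
by apply/seteqP; split=> // v _; exists tt => //; exact: vec0_eq.
Qed.

Lemma pt_atlas_compat c c' : [set pt_chart] c -> [set pt_chart] c' ->
  forall x, cdom c x -> cdom c' x ->
    cnear c x (cdom c') /\ forall i, cregular c x (fun y => ccrd c' y i).
Proof.
by move=> -> -> x _ _; split; [exists 1; rewrite ?meval1 ?oner_eq0 | case].
Qed.

Lemma pt_atlas_separated c c' : [set pt_chart] c -> [set pt_chart] c' ->
  algebraic [set vpair (ccrd c x) (ccrd c' x) | x in cdom c `&` cdom c'].
Proof.
move=> -> ->; apply: algebraic_setT.
by apply/seteqP; split=> // v _; exists tt => //; exact: vec0_eq.
Qed.

Definition pt_variety : variety :=
  Variety (finite_set1 pt_chart) pt_atlas_cover pt_atlas_affine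
    pt_atlas_compat pt_atlas_separated.

Record lcset (X : variety) := LCset {
  lcs :> set X;
  lcsP : locally_closed lcs }.

Section Sub.
Variables (X : variety) (S : lcset X).

(* A finite system of equations of c(Z) when Z is closed *)
Definition eqs (c : chart X) (Z : set X) : seq {mpoly k[cdim c]} :=
  xget [::] [set ps | ccrd c @` (cdom c `&` Z) = zeros ps].

Lemma eqsP (c : chart X) Z x : closed Z -> atlas c -> cdom c x ->
  zeros (eqs c Z) (ccrd c x) <-> Z x.
Proof.
move=> Zc ac cx; have [ps psE] := Zc _ ac.
have := @xgetI _ [::] [set ps | ccrd c @` (cdom c `&` Z) = zeros ps] ps psE.
rewrite -/(eqs c Z) /= => <-; split; last by exists x.
by move=> [y [cy Zy]] /(proj1 (atlas_affine ac) _ _ cy cx) <-.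
Qed.

(* A choice of closed sets with S = lccl minus lcbd *)
Definition lcbd : set X := xget set0 [set B | exists2 A, closed A & closed B /\ S = A `\` B :> set X].
Definition lccl : set X := xget set0 [set A | closed A /\ S = A `\` lcbd :> set X].

Lemma lcbdP : closed lcbd /\ exists2 A, closed A & S = A `\` lcbd :> set X.
Proof.
have [A [B [Ac Bc SE]]] := lcsP S.
have := @xgetI _ set0 [set B | exists2 A, closed A & closed B /\ S = A `\` B :> set X] B.
by rewrite -/lcbd; move=> []; [exists A|move=> A' ? [? ?]; split => //; exists A'].
Qed.

Lemma lcclP : closed lccl /\ S = lccl `\` lcbd :> set X.
Proof.
have [_ [A Ac SE]] := lcbdP.
exact: (@xgetI _ set0 [set A | closed A /\ S = A `\` lcbd :> set X] A).
Qed.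

Notation SX := {x : X | lcs S x}.

(* The part of c in S where b <> 0, with coordinates (c, 1 / b); as b runs over
   equations of lcbd, these parts cover S. *)
Definition sub_chart (c : chart X) (b : {mpoly k[cdim c]}) : chart SX :=
  @Chart SX (cdim c + 1)
    [set x | cdom c (sval x) /\ b.@[ccrd c (sval x)] != 0]
    (fun x => vpair (ccrd c (sval x)) (fun _ : 'I_1 => (b.@[ccrd c (sval x)])^-1)).

Definition sub_atlas : set (chart SX) :=
  \bigcup_(c in @atlas X) [set sub_chart b | b in [set b | b \in eqs c lcbd]].

Lemma sub_near (c : chart X) (b : {mpoly k[cdim c]}) (x : SX) P :
  cnear c (sval x) P -> cnear (sub_chart b) x (fun y => P (sval y)).
Proof.
refine (@cnear_pull _ _ (sub_chart b) c sval _ x P (@polymap_fst k _ _) _ _).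
- by move=> y; rewrite /= vfstK.
- by move=> y [].
Qed.
Lemma sub_regular (c : chart X) (b : {mpoly k[cdim c]}) (x : SX) P :
  cregular c (sval x) P -> cregular (sub_chart b) x (fun y => P (sval y)).
Proof.
refine (@cregular_pull _ _ (sub_chart b) c sval _ x P (@polymap_fst k _ _) _ _).
- by move=> y; rewrite /= vfstK.
- by move=> y [].
Qed.

Lemma sub_atlas_finite : finite_set sub_atlas.
Proof.
apply: bigcup_finite; first exact: atlas_finite.
by move=> c _; apply: finite_image; exact: finite_seq.
Qed.

Lemma sval_inj (x y : SX) : sval x = sval y -> x = y.
Proof. by case: x y => [x Sx] [y Sy] /= xy; subst y; congr exist; exact: Prop_irrelevance. Qed.

Lemma sub_atlas_cover x : exists2 c, sub_atlas c & cdom c x.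
Proof.
have [c ac cx] := atlas_cover (sval x).
have [bc _] := lcbdP; have [_ SE] := lcclP.
have : ~ lcbd (sval x) by case: x {cx} => x /=; rewrite SE => -[].
move/(eqsP bc ac cx) => /existsNP[b /not_implyP[bE /eqP bx]].
by exists (sub_chart b) => //; exists c => //; exists b.
Qed.

Lemma sub_chart_im (c : chart X) (b : {mpoly k[cdim c]}) (w : 'I_(cdim c + 1) -> k) :
  atlas c -> b \in eqs c lcbd ->
  (ccrd (sub_chart b) @` cdom (sub_chart b)) w <->
  (ccrd c @` (cdom c `&` lccl)) (vfst w) /\ b.@[vfst w] * vsnd w ord0 = 1.
Proof.
move=> ac bE; have [bc _] := lcbdP; have [_ SE] := lcclP; split.
  move=> [[x Sx] /= [cx bx] <-]; rewrite vfstK vsndK divff //; split => //.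
  by exists x => //; split => //; move: Sx; rewrite SE => -[].
move=> [[x [cx Ax] xw]]; rewrite -xw => bw.
have bx : b.@[ccrd c x] != 0.
  by apply/eqP => b0; move/eqP: bw; rewrite b0 mul0r eq_sym oner_eq0.
have Sx : lcs S x.
  by rewrite SE; split => // /(eqsP bc ac cx)/(_ _ bE)/eqP; rewrite (negPf bx).
exists (exist _ x Sx) => //=; rewrite -[RHS]vpairK xw; congr vpair.
apply/funext => i; rewrite (ord1 i); apply: (mulfI bx).
by rewrite bw xw divff // -xw.
Qed.

Lemma polyfun_sub n (b : {mpoly k[n]}) :
  polyfun (fun w : 'I_(n + 1) -> k => b.@[vfst w] * vsnd w ord0 - 1).
Proof.
apply: polyfunB; last exact: polyfunC.
apply: polyfunM; first exact: (polyfun_mpoly b (@polymap_fst _ _ _)).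
exact: polyfun_crd.
Qed.

Lemma sub_atlas_affine c : sub_atlas c -> affine_chart c.
Proof.
move=> [{}c ac [b bE <-]]; split.
  move=> x y /= [cx _] [cy _] /(congr1 (@vfst _ _ _)); rewrite !vfstK.
  by move=> /(proj1 (atlas_affine ac) _ _ cx cy); exact: sval_inj.
have [Ac _] := lcclP.
have := algebraicI (algebraic_preim (@polymap_fst _ _ 1) (Ac c ac)) (algebraic_eq0 (polyfun_sub b)).
congr algebraic; apply/seteqP; split => w.
  by move=> [h1 /eqP]; rewrite subr_eq0 => /eqP h2; apply/sub_chart_im.
move=> /(sub_chart_im _ ac bE)[h1 h2]; split => //=.
by rewrite h2 subrr.
Qed.

Lemma sub_atlas_compat c c' : sub_atlas c -> sub_atlas c' ->
    forall x, cdom c x -> cdom c' x ->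
      cnear c x (cdom c') /\ forall i, cregular c x (fun y => ccrd c' y i).
Proof.
move=> [{}c ac [b bE <-]] [{}c' ac' [b' bE' <-]] x [cx bx] [c'x b'x].
have [n1 r1] := atlas_compat ac ac' cx c'x.
have b'r := cregular_mpoly b' r1.
have n2 := cregular_neq0 cx b'r b'x.
split; first exact: cnearI (sub_near b n1) (sub_near b n2).
move=> i /=; rewrite /vpair; case: (fintype.split i) => j.
  exact: sub_regular (r1 j).
exact: (sub_regular b (cregularV cx b'r b'x)).
Qed.

Lemma sub_atlas_separated c c' : sub_atlas c -> sub_atlas c' ->
    algebraic [set vpair (ccrd c x) (ccrd c' x) | x in cdom c `&` cdom c'].
Proof.
move=> sc sc'; have [_ a1] := sub_atlas_affine sc; have [_ a2] := sub_atlas_affine sc'.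
move: sc sc' a1 a2 => [{}c ac [b bE <-]] [{}c' ac' [b' bE' <-]] a1 a2.
have P : @polymap k ((cdim c + 1) + (cdim c' + 1)) _
   (fun w => vpair (vfst (vfst w)) (vfst (vsnd w))).
  apply: polymap_pair; apply: (@polymap_comp k _ _ _ (@vfst k _ _) (@vfst k _ _))
   || apply: (@polymap_comp k _ _ _ (@vsnd k _ _) (@vfst k _ _));
  by [exact: polymap_fst|exact: polymap_snd].
have := algebraicI (algebraic_preim P (atlas_separated ac ac'))
  (algebraicI (algebraic_preim (@polymap_fst _ _ _) a1)
     (algebraic_preim (@polymap_snd _ _ _) a2)).
congr algebraic; apply/seteqP; split => w.
  move=> [[x [cx c'x] wx] [[y1 [/= cy1 by1] yw1] [y2 [/= cy2 by2] yw2]]].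
  have e1 : x = sval y1.
    apply: (proj1 (atlas_affine ac)) => //.
    by rewrite -(vfstK (ccrd c x) (ccrd c' x)) wx vfstK -yw1 vfstK.
  have e2 : x = sval y2.
    apply: (proj1 (atlas_affine ac')) => //.
    by rewrite -(vsndK (ccrd c x) (ccrd c' x)) wx vsndK -yw2 vfstK.
  have e : y1 = y2 by apply: sval_inj; rewrite -e1.
  exists y1; first by split => //=; rewrite e.
  by rewrite -[RHS]vpairK -yw1 -yw2 e.
move=> [y [[cy b1] [c'y b1']] <-]; split; rewrite /preimage /= ?(vfstK, vsndK).
  by exists (sval y) => //; rewrite !(vfstK, vsndK).
by split; exists y.
Qed.

(* The subvariety structure on the locally closed set S *)
Definition sub_variety : variety :=
  Variety sub_atlas_finite sub_atlas_cover sub_atlas_affine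
    sub_atlas_compat sub_atlas_separated.

Lemma hom_sub_morph : @morphism sub_variety X (fun x => sval x).
Proof.
apply: morphism_germ => x phi.
have [_ [c ac [b bE <-]] [cx bx]] := sub_atlas_cover x.
move=> /(regularP _ ac cx) r; exists (sub_chart b); split => //.
  by exists c => //; exists b.
exact: sub_regular r.
Qed.
Definition hom_sub := Hom hom_sub_morph.

Lemma hom_corestr_morph (T : variety) (f : hom T X) (fS : forall t, lcs S (f t)) :
  @morphism T sub_variety (fun t => exist _ (f t) (fS t)).
Proof.
apply: morphism_chart => t.
have [_ [c ac [b bE <-]] [cx bx]] := sub_atlas_cover (exist _ (f t) (fS t)).
have br : regular_at (f t) (fun y => b.@[ccrd c y]).
  by apply/(regularP _ ac cx); exact: cregular_poly.
exists (sub_chart b); split => //; first by exists c => //; exists b.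
  have := vnearI (vnear_dom ac cx) (regular_neq0 br bx).
  exact: hom_near.
move=> i; rewrite /= /vpair; case: (fintype.split i) => j.
  exact: (hom_regular (phi := fun y => ccrd c y j)) (regular_crd _ ac cx).
exact: (hom_regular (phi := fun y => (b.@[ccrd c y])^-1)) (regularV br bx).
Qed.
Definition hom_corestr (T : variety) (f : hom T X) (fS : forall t, lcs S (f t)) :=
  Hom (hom_corestr_morph fS).

End Sub.

End Varieties.

Arguments ccrd {k X} c x i.
Arguments closed {k X}.
Arguments locally_closed {k X}.
Arguments iso {k}.

Section Isos.
Variable k : closedFieldType.
Implicit Types X Y Z T : variety k.

Lemma lcset_eq X (S T : lcset X) : lcs S = lcs T -> S = T.
Proof.
by case: S T => [S Sp] [T Tp] /= e; subst T; congr LCset; exact: Prop_irrelevance.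
Qed.

Lemma locally_closed_preim X Y (f : hom X Y) (S : set Y) :
  locally_closed S -> locally_closed (f @^-1` S).
Proof.
move=> [A [B [Ac Bc ->]]].
by exists (f @^-1` A), (f @^-1` B); split => //; exact: hom_closed.
Qed.

Definition preim_lcset X Y (f : hom X Y) (S : lcset Y) : lcset X :=
  LCset (locally_closed_preim f (lcsP S)).

Lemma sub_hom_eq X (S : lcset X) (x y : sub_variety S) : sval x = sval y -> x = y.
Proof. exact: sval_inj. Qed.

Lemma prod_iso X X' Y : iso X X' -> iso (prod_variety X Y) (prod_variety X' Y).
Proof.
move=> [f [g [fg gf]]].
exists (hom_pair (hom_comp f (hom_fst X Y)) (hom_snd X Y)).
exists (hom_pair (hom_comp g (hom_fst X' Y)) (hom_snd X' Y)).
by split => -[x y] /=; [rewrite fg|rewrite gf].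
Qed.

Lemma prodC_iso X Y : iso (prod_variety X Y) (prod_variety Y X).
Proof.
exists (hom_pair (hom_snd X Y) (hom_fst X Y)), (hom_pair (hom_snd Y X) (hom_fst Y X)).
by split => -[].
Qed.

Lemma prodA_iso X Y Z :
  iso (prod_variety X (prod_variety Y Z)) (prod_variety (prod_variety X Y) Z).
Proof.
pose XYZ := prod_variety X (prod_variety Y Z).
exists (hom_pair (hom_pair (hom_fst X (prod_variety Y Z))
         (hom_comp (hom_fst Y Z) (hom_snd X (prod_variety Y Z))))
         (hom_comp (hom_snd Y Z) (hom_snd X (prod_variety Y Z)))).
exists (hom_pair (hom_comp (hom_fst X Y) (hom_fst (prod_variety X Y) Z))
         (hom_pair (hom_comp (hom_snd X Y) (hom_fst (prod_variety X Y) Z))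
         (hom_snd (prod_variety X Y) Z))).
by split=> [[x [y z]]|[[x y] z]].
Qed.

Definition hom_pt X : hom X (pt_variety k).
Proof.
exists (fun=> tt); apply: morphism_chart => x.
exists (pt_chart k); split => //; first exact: vnearT.
by case.
Defined.

Lemma prod1_iso X : iso (prod_variety (pt_variety k) X) X.
Proof.
exists (hom_snd _ _), (hom_pair (hom_pt X) (hom_id X)).
by split => [[[] x]|x].
Qed.

Lemma sub_prod_iso X Y (S : lcset X) :
  iso (prod_variety (sub_variety S) Y) (sub_variety (preim_lcset (hom_fst X Y) S)).
Proof.
have h1 (p : prod_variety (sub_variety S) Y) :
  lcs (preim_lcset (hom_fst X Y) S)
    ((hom_pair (hom_comp (hom_sub S) (hom_fst _ _)) (hom_snd _ _)) p) by exact: (svalP p.1).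
have h2 (p : sub_variety (preim_lcset (hom_fst X Y) S)) :
  lcs S (hom_comp (hom_fst X Y) (hom_sub _) p) by exact: (svalP p).
exists (hom_corestr h1), (hom_pair (hom_corestr h2) (hom_comp (hom_snd X Y) (hom_sub _))).
split=> [[x y]|x].
  by congr pair; exact: sub_hom_eq.
by apply: sub_hom_eq => /=; case: x => -[].
Qed.

Definition lcsetI X (S T : lcset X) : lcset X :=
  LCset (locally_closedI (lcsP S) (lcsP T)).

Lemma sub_sub_iso X (S T : lcset X) :
  iso (sub_variety (preim_lcset (hom_sub S) T)) (sub_variety (lcsetI S T)).
Proof.
have h1 (p : sub_variety (preim_lcset (hom_sub S) T)) :
  lcs (lcsetI S T) (hom_comp (hom_sub S) (hom_sub _) p).
  by split; [exact: (svalP (sval p))|exact: (svalP p)].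
have h2 (p : sub_variety (lcsetI S T)) : lcs S (hom_sub _ p) by exact: (proj1 (svalP p)).
have h3 (p : sub_variety (lcsetI S T)) : lcs (preim_lcset (hom_sub S) T) (hom_corestr h2 p).
  by exact: (proj2 (svalP p)).
exists (hom_corestr h1), (hom_corestr h3); split => x.
  by do 2 apply: sub_hom_eq.
exact: sub_hom_eq.
Qed.

Definition lcsetT X : lcset X := LCset (locally_closed_closed (@closedT k X)).

Lemma sub_setT_iso X (S : lcset X) : S = setT :> set X -> iso (sub_variety S) X.
Proof.
move=> ST; have h x : lcs S (hom_id X x) by rewrite ST.
exists (hom_sub S), (hom_corestr h); split => x //.
exact: sub_hom_eq.
Qed.

End Isos.

HB.instance Definition _ (k : closedFieldType) := gen_eqMixin (variety k).
HB.instance Definition _ (k : closedFieldType) := gen_choiceMixin (variety k).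

Section K0.
Variable k : closedFieldType.
Implicit Types V W : variety k.

Definition closed_lcset V (Z : set V) (Zc : closed Z) : lcset V :=
  LCset (locally_closed_closed Zc).
Definition open_lcset V (Z : set V) (Zc : closed Z) : lcset V :=
  LCset (locally_closedC Zc).

(* The subgroup of scissors relations in the free abelian group on varieties *)
Inductive K0_rel : {freeg variety k} -> Prop :=
| K0_rel_iso V W : iso V W -> K0_rel (<< V >> - << W >>)
| K0_rel_cut V (Z : set V) (Zc : closed Z) :
    K0_rel (<< V >> - (<< sub_variety (closed_lcset Zc) >> +
                       << sub_variety (open_lcset Zc) >>))
| K0_rel0 : K0_rel 0
| K0_relB x y : K0_rel x -> K0_rel y -> K0_rel (x - y).

Definition K0_relb : {pred {freeg variety k}} := fun x => `[< K0_rel x >].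

Lemma K0_relb_closed : zmod_closed K0_relb.
Proof.
split; first by apply/asboolP; exact: K0_rel0.
by move=> x y /asboolP hx /asboolP hy; apply/asboolP; exact: K0_relB.
Qed.
HB.instance Definition _ := GRing.isZmodClosed.Build _ K0_relb K0_relb_closed.

Definition K0 := Quotient.quot K0_relb.
HB.instance Definition _ := GRing.Zmodule.on K0.

Definition K0_pi (x : {freeg variety k}) : K0 := (\pi_(Quotient.quot K0_relb) x)%qT.

Lemma K0_pi_additive : additive K0_pi.
Proof.
move=> x y; rewrite /K0_pi.
by rewrite -[RHS]/(_ - _) !piE.
Qed.
HB.instance Definition _ := GRing.isAdditive.Build _ _ K0_pi K0_pi_additive.

Definition K0_class V : K0 := K0_pi << V >>.

Lemma K0_pi_eq x y : K0_rel (x - y) -> K0_pi x = K0_pi y.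
Proof.
move=> h; apply/eqP; rewrite /K0_pi -Quotient.idealrBE; exact/asboolP.
Qed.

Lemma K0_iso V W : iso V W -> K0_class V = K0_class W.
Proof. by move=> h; apply/K0_pi_eq/K0_rel_iso. Qed.

Lemma K0_cut V (Z : set V) (Zc : closed Z) :
  K0_class V = K0_class (sub_variety (closed_lcset Zc)) +
               K0_class (sub_variety (open_lcset Zc)).
Proof. by rewrite /K0_class -raddfD; apply/K0_pi_eq/K0_rel_cut. Qed.

Section Lift.
Variables (A : zmodType) (e : variety k -> A).
Hypothesis e_iso : forall V W, iso V W -> e V = e W.
Hypothesis e_cut : forall V (Z : set V) (Zc : closed Z),
  e V = e (sub_variety (closed_lcset Zc)) + e (sub_variety (open_lcset Zc)).

Definition fg_lift (x : {freeg variety k}) : A := fglift (M := zmodule A) e x.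
Lemma fg_lift_additive : additive fg_lift.
Proof. exact: (@lift_is_additive int _ (zmodule A) e). Qed.
HB.instance Definition _ := GRing.isAdditive.Build _ _ fg_lift fg_lift_additive.

Lemma fg_liftU V : fg_lift << V >> = e V.
Proof. by rewrite /fg_lift liftU scale1r. Qed.

Lemma fg_lift_rel x : K0_rel x -> fg_lift x = 0.
Proof.
elim=> {x} [V W h|V Z Zc||x y _ hx _ hy].
- by rewrite raddfB /= !fg_liftU (e_iso h) subrr.
- by rewrite raddfB raddfD /= !fg_liftU -e_cut subrr.
- by rewrite raddf0.
- by rewrite raddfB /= hx hy subrr.
Qed.

Definition K0_lift (x : K0) : A := fg_lift (repr x).

Lemma K0_lift_pi x : K0_lift (K0_pi x) = fg_lift x.
Proof.
rewrite /K0_lift; apply/eqP; rewrite -subr_eq0 -raddfB /=; apply/eqP/fg_lift_rel.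
have /eqP := reprK (K0_pi x); rewrite /K0_pi -Quotient.idealrBE.
by move/asboolP.
Qed.

Lemma K0_lift_class V : K0_lift (K0_class V) = e V.
Proof. by rewrite /K0_class K0_lift_pi fg_liftU. Qed.

Lemma K0_piP (x : K0) : exists y, x = K0_pi y.
Proof. by exists (repr x); rewrite /K0_pi reprK. Qed.

Lemma K0_lift_additive : additive K0_lift.
Proof.
move=> x y; have [x' ->] := K0_piP x; have [y' ->] := K0_piP y.
by rewrite -raddfB !K0_lift_pi raddfB.
Qed.

End Lift.

Lemma K0_ind (P : K0 -> Prop) : (forall V, P (K0_class V)) -> P 0 ->
  (forall x y, P x -> P y -> P (x - y)) -> forall x, P x.
Proof.
move=> Pc P0 PB x.
have PN y : P y -> P (- y) by move=> Py; rewrite -sub0r; exact: PB.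
have PD y z : P y -> P z -> P (y + z) by move=> Py Pz; rewrite -[z]opprK; apply: PB => //; exact: PN.
have Pm V (n : int) : P (K0_class V *~ n).
  have Pn (n' : nat) : P (K0_class V *+ n').
    by elim: n' => [|n' IH]; rewrite ?mulr0n // mulrS; apply: PD.
  by case: n => n; [exact: Pn | rewrite NegzE mulrNz; apply: PN; exact: Pn].
have [y ->] := K0_piP x; rewrite -[y]freeg_sumE raddf_sum /=.
elim/big_ind: _ => // V _; rewrite (_ : K0_pi _ = K0_class V *~ coeff V y) //.
rewrite /K0_class -raddfMz /=; congr K0_pi.
by apply/eqP/freeg_eqP => W; rewrite coeffU raddfMz /= coeffU mul1r -mulrzl intz.
Qed.

Lemma K0_additive_eq (A : zmodType) (f g : K0 -> A) : additive f -> additive g ->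
  (forall V, f (K0_class V) = g (K0_class V)) -> f =1 g.
Proof.
move=> fa ga fg x; elim/K0_ind: x => [//| |x y xe ye]; last by rewrite fa ga xe ye.
by rewrite -[0](subrr 0) fa ga !subrr.
Qed.

Definition K0_mul_class W : K0 -> K0 := K0_lift (fun V => K0_class (prod_variety V W)).

Lemma prod_class_iso W V V' : iso V V' ->
  K0_class (prod_variety V W) = K0_class (prod_variety V' W).
Proof. by move=> /(prod_iso W)/K0_iso. Qed.

Lemma prod_class_cut W V (Z : set V) (Zc : closed Z) :
  K0_class (prod_variety V W) = K0_class (prod_variety (sub_variety (closed_lcset Zc)) W) +
               K0_class (prod_variety (sub_variety (open_lcset Zc)) W).
Proof.
rewrite (K0_cut (hom_closed (hom_fst V W) Zc)).
rewrite (K0_iso (sub_prod_iso W (closed_lcset Zc))) (K0_iso (sub_prod_iso W (open_lcset Zc))).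
by congr (_ + _); congr (K0_class (sub_variety _)); exact: lcset_eq.
Qed.

Lemma K0_mul_classE W V : K0_mul_class W (K0_class V) = K0_class (prod_variety V W).
Proof. exact: (K0_lift_class (@prod_class_iso W) (@prod_class_cut W)). Qed.

Lemma K0_mul_class_additive W : additive (K0_mul_class W).
Proof. exact: (K0_lift_additive (@prod_class_iso W) (@prod_class_cut W)). Qed.

Lemma mul_class_iso W W' : iso W W' -> K0_mul_class W = K0_mul_class W' :> (K0 -> K0).
Proof.
move=> h; apply/funext/K0_additive_eq; try exact: K0_mul_class_additive.
move=> V; rewrite !K0_mul_classE (K0_iso (prodC_iso _ _)) (prod_class_iso _ h).
exact: K0_iso (prodC_iso _ _).
Qed.

Lemma mul_class_cut W (Z : set W) (Zc : closed Z) :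
  K0_mul_class W = K0_mul_class (sub_variety (closed_lcset Zc)) +
                   K0_mul_class (sub_variety (open_lcset Zc)) :> (K0 -> K0).
Proof.
apply/funext/K0_additive_eq; first exact: K0_mul_class_additive.
  move=> x y; rewrite -[LHS]/(_ (x - y) + _ (x - y)) !K0_mul_class_additive.
  by rewrite addrACA -opprD.
move=> V; rewrite -[RHS]/(_ (K0_class V) + _ (K0_class V)) !K0_mul_classE.
rewrite (K0_iso (prodC_iso _ _)) (prod_class_cut V Zc).
by congr (_ + _); apply: K0_iso (prodC_iso _ _).
Qed.

(* The biadditive extension of [V][W] = [V x W], see K0_mulE *)
Definition K0_mul (x y : K0) : K0 := (K0_lift K0_mul_class y : K0 -> K0) x.

Lemma K0_mulE V W : K0_mul (K0_class V) (K0_class W) = K0_class (prod_variety V W).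
Proof.
by rewrite /K0_mul (K0_lift_class mul_class_iso mul_class_cut) K0_mul_classE.
Qed.

Lemma K0_mulr_additive x : additive (K0_mul x).
Proof. by move=> y z; rewrite /K0_mul (K0_lift_additive mul_class_iso mul_class_cut). Qed.

Lemma K0_mull_additive y : additive (K0_mul^~ y).
Proof.
elim/K0_ind: y; [move=> W x x'| |move=> y y' hy hy' x x'].
- by rewrite /K0_mul (K0_lift_class mul_class_iso mul_class_cut) K0_mul_class_additive.
- move=> x x'; have z t : K0_mul t 0 = 0 by rewrite -(subrr 0) K0_mulr_additive !subrr.
  by rewrite !z subrr.
- rewrite !K0_mulr_additive hy hy'.
  by rewrite !opprB addrACA [RHS]addrACA; congr (_ + _); rewrite addrC.
Qed.

Definition K0_one : K0 := K0_class (pt_variety k).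

Lemma K0_mulC : commutative K0_mul.
Proof.
move=> x y; move: x; apply: K0_additive_eq; [exact: K0_mull_additive|exact: K0_mulr_additive|].
move=> V; move: y; apply: K0_additive_eq; [exact: K0_mulr_additive|exact: K0_mull_additive|].
by move=> W; rewrite !K0_mulE; exact: K0_iso (prodC_iso _ _).
Qed.

Lemma K0_mul1 : left_id K0_one K0_mul.
Proof.
apply: K0_additive_eq => [||V]; [exact: K0_mulr_additive|by move=> x y|].
by rewrite K0_mulE; exact: K0_iso (prod1_iso _).
Qed.

Lemma K0_mulDl : left_distributive K0_mul +%R.
Proof.
move=> x y z; have N t : K0_mul (- t) z = - K0_mul t z.
  have z0 : K0_mul 0 z = 0 by rewrite -(subrr 0) K0_mull_additive !subrr.
  by rewrite -[- t]sub0r K0_mull_additive z0 sub0r.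
by have := K0_mull_additive z x (- y); rewrite opprK N opprK.
Qed.

Lemma K0_mulA : associative K0_mul.
Proof.
move=> x y z; move: x; apply: K0_additive_eq.
- exact: K0_mull_additive.
- by move=> a b; rewrite !K0_mull_additive.
move=> U; move: y; apply: K0_additive_eq.
- by move=> a b; rewrite K0_mull_additive K0_mulr_additive.
- by move=> a b; rewrite K0_mulr_additive K0_mull_additive.
move=> V; move: z; apply: K0_additive_eq.
- by move=> a b; rewrite !K0_mulr_additive.
- exact: K0_mulr_additive.
by move=> W; rewrite !K0_mulE; exact: K0_iso (prodA_iso _ _ _).
Qed.

HB.instance Definition _ := GRing.Zmodule_isComPzRing.Build K0 K0_mulA K0_mulC K0_mul1 K0_mulDl.

End K0.

HB.instance Definition _ (k : closedFieldType) (X : variety k) := gen_eqMixin (lcset X).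

Section Constructible.
Variables (k : closedFieldType) (X : variety k).
Implicit Types (S T W : lcset X).

Definition lc_class S : K0 k := K0_class (sub_variety S).

Lemma lc_class0 S : S = set0 :> set X -> lc_class S = 0.
Proof.
move=> S0; have := K0_cut (@closed0 k X).
rewrite [X in _ = _ + X](K0_iso (sub_setT_iso _)); last by rewrite /= setC0.
rewrite -[X in X = _]add0r => /addIr ->; rewrite /lc_class.
by congr (K0_class (sub_variety _)); exact: lcset_eq.
Qed.

Lemma lc_cut W (Z : set X) (Zc : closed Z) : lc_class W =
  lc_class (lcsetI W (closed_lcset Zc)) + lc_class (lcsetI W (open_lcset Zc)).
Proof.
rewrite /lc_class (K0_cut (hom_closed (hom_sub W) Zc)).
rewrite -(K0_iso (sub_sub_iso W (closed_lcset Zc))) -(K0_iso (sub_sub_iso W (open_lcset Zc))).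
by congr (_ + _); congr (K0_class (sub_variety _)); exact: lcset_eq.
Qed.

(* The function sum_W a_W 1_W *)
Definition comb (t : seq (int * lcset X)) (x : X) : int :=
  \sum_(p <- t) (x \in lcs p.2)%:R * p.1.

Definition lc_eqs (t : seq (int * lcset X)) : seq (set X) :=
  flatten [seq [:: lccl p.2; lcbd p.2] | p <- t].

Lemma lc_eqs_closed t Z : Z \in lc_eqs t -> closed Z.
Proof.
move=> /flatten_mapP[p _]; rewrite !inE => /orP[] /eqP ->.
  exact: (proj1 (lcclP _)).
exact: (proj1 (lcbdP _)).
Qed.

Lemma lc_eqs_sat t p x y : p \in t ->
  (forall Z, Z \in lc_eqs t -> Z x <-> Z y) -> lcs p.2 x <-> lcs p.2 y.
Proof.
move=> pt h; have h1 : lccl p.2 x <-> lccl p.2 y.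
  by apply: h; apply/flatten_mapP; exists p; rewrite // !inE eqxx.
have h2 : lcbd p.2 x <-> lcbd p.2 y.
  by apply: h; apply/flatten_mapP; exists p; rewrite // !inE eqxx orbT.
by rewrite (proj2 (lcclP p.2)); split => -[a b]; split => //; tauto.
Qed.

Lemma comb_class0_rec (zs : seq (set X)) (t : seq (int * lcset X)) W :
  (forall Z, Z \in zs -> closed Z) ->
  (forall p x y, p \in t -> lcs W x -> lcs W y ->
     (forall Z, Z \in zs -> Z x <-> Z y) -> lcs p.2 x <-> lcs p.2 y) ->
  (forall x, lcs W x -> comb t x = 0) ->
  \sum_(p <- t) lc_class (lcsetI W p.2) *~ p.1 = 0.
Proof.
elim: zs W => [|Z zs IH] W zsc sat W0.
  have [[x Wx]|We] := pselect (exists x, lcs W x); last first.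
    rewrite big1_seq // => p _; rewrite lc_class0 ?mul0rz //.
    by apply/seteqP; split => // x [Wx _]; apply: We; exists x.
  transitivity (lc_class W *~ comb t x); last by rewrite W0 ?mulr0z.
  rewrite /comb mulrz_sumr; apply: eq_big_seq => p pt.
  have [xp|xp] := boolP (x \in lcs p.2).
    rewrite mul1r; congr (lc_class _ *~ _); apply: lcset_eq; apply/seteqP; split => y; [by case|move=> Wy; split => //; apply/(sat p x y) => //; exact/set_mem].
  rewrite mul0r mulr0z lc_class0 ?mul0rz //; apply/seteqP; split => // y [Wy py].
  by move/negP: xp; apply; apply/mem_set/(sat p x y).
have Zc : closed Z by apply: zsc; rewrite inE eqxx.
have step (U : lcset X) : (forall x, lcs U x -> lcs W x) ->
    (forall x y, lcs U x -> lcs U y -> Z x <-> Z y) ->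
    \sum_(p <- t) lc_class (lcsetI U p.2) *~ p.1 = 0.
  move=> UW UZ; apply: IH => [Z' h|p x y pt Ux Uy h|x /UW]; last exact: W0.
    by apply: zsc; rewrite inE h orbT.
  apply: (sat _ _ _ pt (UW _ Ux) (UW _ Uy)) => Z'; rewrite inE => /orP[/eqP->|Z'zs].
    exact: UZ.
  exact: h.
transitivity (\sum_(p <- t) (lc_class (lcsetI (lcsetI W (closed_lcset Zc)) p.2) *~ p.1 +
   lc_class (lcsetI (lcsetI W (open_lcset Zc)) p.2) *~ p.1)).
  apply: eq_bigr => p _; rewrite (lc_cut _ Zc) mulrzDl; congr (lc_class _ *~ _ + lc_class _ *~ _);
  by apply: lcset_eq; rewrite /= setIAC.
rewrite big_split /= !step ?addr0 //.
- by move=> x [].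
- by move=> x y [_ /= ?] [_ /= ?]; split.
- by move=> x [].
- by move=> x y [_ /= ?] [_ /= ?]; split.
Qed.

(* The class of a combination only depends on the function it represents *)
Lemma comb_class0 (t : seq (int * lcset X)) : (forall x, comb t x = 0) ->
  \sum_(p <- t) lc_class p.2 *~ p.1 = 0.
Proof.
move=> t0; have := @comb_class0_rec (lc_eqs t) t (lcsetT X) (@lc_eqs_closed t).
move=> h; rewrite -[RHS]h => [|p x y pt _ _|x _]; last exact: t0.
  by apply: eq_bigr => p _; congr (lc_class _ *~ _); apply: lcset_eq; rewrite /= setTI.
exact: lc_eqs_sat.
Qed.

Definition negc (t : seq (int * lcset X)) := [seq (- p.1, p.2) | p <- t].

Lemma comb_cat t t' x : comb (t ++ t') x = comb t x + comb t' x.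
Proof. by rewrite /comb big_cat. Qed.
Lemma combN t x : comb (negc t) x = - comb t x.
Proof. by rewrite /comb big_map -sumrN; apply: eq_bigr => p _; rewrite mulrN. Qed.

Lemma comb_class_eq (t t' : seq (int * lcset X)) : comb t =1 comb t' ->
  \sum_(p <- t) lc_class p.2 *~ p.1 = \sum_(p <- t') lc_class p.2 *~ p.1.
Proof.
move=> tt'; apply/eqP; rewrite -subr_eq0; apply/eqP.
have := @comb_class0 (t ++ negc t'); rewrite big_cat big_map => h.
rewrite -[RHS]h; last by move=> x; rewrite comb_cat combN tt' subrr.
congr (_ + _); rewrite -sumrN; apply: eq_bigr => p _ /=.
by rewrite mulrNz.
Qed.

(* s is a partition of S: each point of S lies in exactly one piece, and
   the other points lie in none. *)
Definition lc_partition (s : seq (lcset X)) (S : set X) :=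
  forall x, count (fun W => x \in lcs W) s = (x \in S).

(* The choice of the partition is immaterial: see constr_classE. *)
Definition constr_class (S : set X) : K0 k :=
  xget 0 [set c | exists2 s, lc_partition s S & c = \sum_(W <- s) lc_class W].

Definition constructible (S : set X) :=
  exists s : seq (lcset X), S = [set x | exists2 W, W \in s & lcs W x].

Lemma comb1 s x : comb [seq (1, W) | W <- s] x = (count (fun W => x \in lcs W) s)%:R.
Proof.
rewrite /comb big_map; elim: s => [|W s IH]; first by rewrite big_nil.
by rewrite big_cons IH /= natrD mulr1.
Qed.

Lemma constr_classE s (S : set X) : lc_partition s S -> constr_class S = \sum_(W <- s) lc_class W.
Proof.
move=> sS; have h (r : seq (lcset X)) :
    \sum_(W <- r) lc_class W = \sum_(p <- [seq (1, W) | W <- r]) lc_class p.2 *~ p.1.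
  by rewrite big_map; apply: eq_bigr.
rewrite /constr_class; case: xgetP => [_ -> [s' s'S ->]|/(_ (\sum_(W <- s) lc_class W))[]]; last by exists s.
by rewrite !h; apply: comb_class_eq => x; rewrite !comb1 sS s'S.
Qed.

Lemma atoms (zs : seq (set X)) : (forall Z, Z \in zs -> closed Z) ->
  exists2 s : seq (lcset X), lc_partition s setT &
    forall W, W \in s -> forall x y, lcs W x -> lcs W y -> forall Z, Z \in zs -> Z x <-> Z y.
Proof.
elim: zs => [|Z zs IH] zsc.
  exists [:: lcsetT X] => [x|W]; last by move=> _ ? ? _ _.
  by rewrite /= addn0.
have [s sP sS] : exists2 s : seq (lcset X), lc_partition s setT &
    forall W, W \in s -> forall x y, lcs W x -> lcs W y -> forall Z, Z \in zs -> Z x <-> Z y.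
  by apply: IH => Z' h; apply: zsc; rewrite inE h orbT.
have Zc : closed Z by apply: zsc; rewrite inE eqxx.
exists ([seq lcsetI W (closed_lcset Zc) | W <- s] ++ [seq lcsetI W (open_lcset Zc) | W <- s]).
  move=> x; rewrite count_cat !count_map -sP.
  have [xZ|xZ] := pselect (Z x).
    rewrite [X in (_ + X)%N](_ : _ = 0%N) ?addn0; last first.
      apply/eqP; rewrite -leqn0 leqNgt -has_count; apply/hasP => -[W _] /=.
      by move=> /set_mem[_ /(_ xZ)].
    by apply: eq_count => W /=; apply/idP/idP => [/set_mem[]/mem_set//|/set_mem ?]; apply/mem_set.
  rewrite [X in (X + _)%N](_ : _ = 0%N) ?add0n; last first.
    apply/eqP; rewrite -leqn0 leqNgt -has_count; apply/hasP => -[W _] /=.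
    by move=> /set_mem[_ /xZ].
  by apply: eq_count => W /=; apply/idP/idP => [/set_mem[]/mem_set//|/set_mem ?]; apply/mem_set.
move=> W; rewrite mem_cat => /orP[] /mapP[W' W's ->] x y [Wx Zx] [Wy Zy] Z'; rewrite inE;
  by move=> /orP[/eqP->|Z'zs]; [split|exact: (sS W')].
Qed.

End Constructible.

Section Fun.
Variable k : closedFieldType.

(* Finite Z-linear combinations of characteristic functions of subvarieties *)
Definition constructible_fun (X : variety k) (a : X -> int) :=
  exists t : seq (int * lcset X), a =1 comb t.

Definition constructible_funb (X : variety k) : {pred (X -> int)} :=
  fun a => `[< constructible_fun a >].

Lemma constructible_funb_closed X : zmod_closed (@constructible_funb X).
Proof.
split; first by apply/asboolP; exists [::] => x; rewrite /comb big_nil.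
move=> a b /asboolP[t at'] /asboolP[t' bt]; apply/asboolP; exists (t ++ negc t') => x.
by rewrite comb_cat combN -at' -bt.
Qed.
HB.instance Definition _ X :=
  GRing.isZmodClosed.Build _ (@constructible_funb X) (@constructible_funb_closed X).

Record cfun (X : variety k) := CFun {
  cfun_val :> X -> int;
  cfun_valP : cfun_val \in @constructible_funb X }.
HB.instance Definition _ X := [isSub for @cfun_val X].
HB.instance Definition _ X := [Choice of cfun X by <:].
HB.instance Definition _ X := [SubChoice_isSubZmodule of cfun X by <:].

Lemma cfunP (X : variety k) (a : cfun X) : constructible_fun a.
Proof. exact/asboolP/(cfun_valP a). Qed.

Lemma cfun_eq (X : variety k) (a b : cfun X) : a =1 b -> a = b.
Proof. by move=> ab; apply: val_inj; apply/funext. Qed.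

Lemma pullback_subproof (X Y : variety k) (f : hom X Y) (a : cfun Y) :
  (a \o f) \in @constructible_funb X.
Proof.
apply/asboolP; have [t at'] := cfunP a.
exists [seq (p.1, preim_lcset f p.2) | p <- t] => x /=.
rewrite at' /comb big_map; apply: eq_bigr => p _ /=.
by congr (_%:R * _); congr nat_of_bool; rewrite !inE.
Qed.

Definition pullback (X Y : variety k) (f : hom X Y) (a : cfun Y) : cfun X :=
  CFun (pullback_subproof f a).

Lemma pullback_additive X Y (f : hom X Y) : additive (pullback f).
Proof. by move=> a b; exact: cfun_eq. Qed.
HB.instance Definition _ X Y (f : hom X Y) :=
  GRing.isAdditive.Build _ _ (pullback f) (pullback_additive f).

(* A sum over all integers n, in which finitely many terms are nonzero *)
Definition Gamma (X : variety k) (a : cfun X) : K0 k :=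
  \sum_(n \in [set: int]) constr_class (a @^-1` [set n]) *~ n.

Lemma GammaE (X : variety k) (a : cfun X) t : a =1 comb t ->
  Gamma a = \sum_(p <- t) lc_class p.2 *~ p.1.
Proof.
move=> at'; have [s0 s0P s0S] := atoms (@lc_eqs_closed _ _ t).
pose s := [seq W <- s0 | `[< exists x, lcs W x >]].
have sP : lc_partition s setT.
  move=> x; rewrite -s0P count_filter; apply: eq_count => W /=.
  rewrite andb_idr // => /set_mem xW; apply/asboolP; by exists x.
have sn W : W \in s -> exists x, lcs W x by rewrite mem_filter => /andP[/asboolP].
pose v W : int := xget 0 [set n | exists2 x, lcs W x & a x = n].
have vP W x : W \in s -> lcs W x -> a x = v W.
  move=> Ws Wx; rewrite /v; case: xgetP => [_ -> [y Wy <-]|/(_ (a x))[]]; last by exists x.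
  have Ws0 : W \in s0 by move: Ws; rewrite mem_filter => /andP[].
  rewrite !at' /comb; apply: eq_big_seq => p pt; congr (_%:R * _); congr nat_of_bool.
  have e : lcs p.2 x <-> lcs p.2 y by apply: (lc_eqs_sat pt); exact: (s0S W).
  by apply/idP/idP => /set_mem/e/mem_set.
have clsE n : constr_class (a @^-1` [set n]) = \sum_(W <- s | v W == n) lc_class W.
  rewrite -big_filter; refine (constr_classE (s := [seq W <- s | v W == n]) _) => x; rewrite count_filter.
  have /= sx := sP x; rewrite in_setT /= in sx.
  have [an|an] := boolP (x \in a @^-1` [set n]).
    rewrite -[RHS]sx; apply: eq_in_count => W Ws /=; rewrite andb_idr // => /set_mem Wx.
    by rewrite -(vP W x Ws Wx); apply/eqP/(set_mem an).
  apply/eqP; rewrite -leqn0 leqNgt -has_count; apply/hasP => -[W Ws] /= /andP[/set_mem Wx /eqP vn].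
  by move/negP: an; apply; apply/mem_set; rewrite /= (vP W x Ws Wx).
pose vs := undup [seq v W | W <- s].
have vsP W : W \in s -> v W \in vs by move=> Ws; rewrite mem_undup; exact: map_f.
rewrite /Gamma -(fsbig_widen [set` vs]) //; last first.
  move=> n [_ nvs]; rewrite /preimage /= clsE big1_seq ?mul0rz // => W /andP[/eqP vn Ws].
  by case: nvs => /=; rewrite -vn; exact: vsP.
rewrite -fsbig_seq ?undup_uniq //.
transitivity (\sum_(W <- s) lc_class W *~ v W).
  under eq_bigr => n _ do rewrite clsE mulrz_suml big_mkcond /=.
  rewrite exchange_big /=; apply: eq_big_seq => W Ws.
  rewrite (bigD1_seq (v W)) ?undup_uniq ?vsP //= eqxx big1 ?addr0 // => n nv.
  by rewrite eq_sym (negPf nv).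
transitivity (\sum_(p <- [seq (v W, W) | W <- s]) lc_class p.2 *~ p.1).
  by rewrite big_map.
apply: comb_class_eq => x; rewrite -at' /comb big_map /=.
rewrite (eq_big_seq (fun W => (x \in lcs W)%:R * a x)); last first.
  move=> W Ws /=; have [/set_mem xW|] := boolP (x \in lcs W); last by rewrite !mul0r.
  by rewrite (vP W x).
have cE (r : seq (lcset X)) : (\sum_(W <- r) (x \in lcs W))%N = count (fun W => x \in lcs W) r.
  by elim: r => [|W r IH]; rewrite ?big_nil // big_cons IH.
by rewrite -mulr_suml -natr_sum cE sP in_setT mul1r.
Qed.

Lemma Gamma_additive X : additive (@Gamma X).
Proof.
move=> a b; have [t at'] := cfunP a; have [t' bt] := cfunP b.
rewrite (GammaE at') (GammaE bt) (@GammaE _ (a - b) (t ++ negc t')).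
  rewrite big_cat big_map /= -sumrN; congr (_ + _); apply: eq_bigr => p _.
  by rewrite mulrNz.
by move=> x; rewrite comb_cat combN -at' -bt.
Qed.
HB.instance Definition _ X :=
  GRing.isAdditive.Build _ _ (@Gamma X) (@Gamma_additive X).

End Fun.

Definition directed d (L : preorderType d) :=
  (exists i : L, True) /\ forall i j : L, exists l, (i <= l)%O /\ (j <= l)%O.

Record dirsys d (L : preorderType d) := DirSys {
  dobj :> L -> zmodType;
  dmap : forall i j, (i <= j)%O -> {additive dobj i -> dobj j};
  dmap_id : forall i (h : (i <= i)%O) x, dmap h x = x;
  dmap_comp : forall i j l (hij : (i <= j)%O) (hjl : (j <= l)%O) (hil : (i <= l)%O) x,
    dmap hjl (dmap hij x) = dmap hil x }.
Arguments dmap {d L} D {i j} h : rename.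

Section DirLim.
Variables (d : Order.disp_t) (L : preorderType d) (dir : directed L) (D : dirsys L).

Local Notation fam := {i : L & dobj D i}.

(* Two elements are identified when they become equal further on *)
Definition dirlim_rel (x y : fam) : bool :=
  `[< exists l (hx : (tag x <= l)%O) (hy : (tag y <= l)%O),
        dmap D hx (tagged x) = dmap D hy (tagged y) >].

Lemma dirlim_rel_equiv : equiv_class_of dirlim_rel.
Proof.
split=> [x|x y|y x z].
- by apply/asboolP; exists (tag x), (lexx _), (lexx _).
- by apply/asboolP/asboolP => -[l [h [h' e]]]; exists l, h', h.
move=> /asboolP[l [hx [hy e]]] /asboolP[m [hy' [hz e']]]; apply/asboolP.
have [p [lp mp]] := (proj2 dir) l m.
exists p, (le_trans hx lp), (le_trans hz mp).
rewrite -(dmap_comp hx lp) e -(dmap_comp hz mp) -e'.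
by rewrite (dmap_comp hy lp (le_trans hy lp)) (dmap_comp hy' mp (le_trans hy lp)).
Qed.

Canonical dirlim_equiv := EquivRelPack dirlim_rel_equiv.
Canonical dirlim_enc := defaultEncModRel dirlim_rel.

Local Open Scope quotient_scope.

Definition dirlim := {eq_quot dirlim_rel}.
HB.instance Definition _ := Choice.on dirlim.

Definition dirlim_in (i : L) (x : dobj D i) : dirlim :=
  \pi_(dirlim) (Tagged (dobj D) x).

Lemma dirlim_in_eq i j (x : D i) (y : D j) : dirlim_in x = dirlim_in y <->
  exists l (hx : (i <= l)%O) (hy : (j <= l)%O), dmap D hx x = dmap D hy y.
Proof.
rewrite /dirlim_in; split.
  by move/eqmodP/asboolP.
by move=> h; apply/eqmodP/asboolP.
Qed.

Lemma dirlim_inP (z : dirlim) : exists i (x : D i), z = dirlim_in x.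
Proof.
exists (tag (repr z)), (tagged (repr z)).
by rewrite /dirlim_in -[LHS]reprK; case: (repr z).
Qed.

Lemma dirlim_in_map i j (h : (i <= j)%O) (x : D i) : dirlim_in (dmap D h x) = dirlim_in x.
Proof.
apply/dirlim_in_eq; exists j, (lexx j), h.
by rewrite (dmap_comp h (lexx j) h).
Qed.

Definition ub_index i j : L := sval (cid (proj2 dir i j)).
Lemma ub_index_l i j : (i <= ub_index i j)%O.
Proof. exact: (proj1 (svalP (cid (proj2 dir i j)))). Qed.
Lemma ub_index_r i j : (j <= ub_index i j)%O.
Proof. exact: (proj2 (svalP (cid (proj2 dir i j)))). Qed.

Definition dirlim_zero : dirlim := dirlim_in (0 : D (sval (cid (proj1 dir)))).
Definition dirlim_opp (z : dirlim) : dirlim := dirlim_in (- tagged (repr z)).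
Definition dirlim_add (z w : dirlim) : dirlim :=
  dirlim_in (dmap D (ub_index_l (tag (repr z)) (tag (repr w))) (tagged (repr z)) +
             dmap D (ub_index_r (tag (repr z)) (tag (repr w))) (tagged (repr w))).

Lemma dirlim_zeroE i : dirlim_zero = dirlim_in (0 : D i).
Proof.
apply/dirlim_in_eq; set j := sval _.
by exists (ub_index j i), (ub_index_l _ _), (ub_index_r _ _); rewrite !raddf0.
Qed.

Lemma repr_dirlim_in i (x : D i) : dirlim_in (tagged (repr (dirlim_in x))) = dirlim_in x.
Proof. by rewrite [RHS]/dirlim_in -[RHS]reprK /dirlim_in; case: (repr _). Qed.

Lemma dirlim_oppE i (x : D i) : dirlim_opp (dirlim_in x) = dirlim_in (- x).
Proof.
have /dirlim_in_eq[l [h1 [h2 e]]] := repr_dirlim_in x.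
by apply/dirlim_in_eq; exists l, h1, h2; rewrite !raddfN e.
Qed.

Lemma dirlim_addE i (x y : D i) :
  dirlim_add (dirlim_in x) (dirlim_in y) = dirlim_in (x + y).
Proof.
have /dirlim_in_eq[l [h1 [h2 e]]] := repr_dirlim_in x.
have /dirlim_in_eq[m [h3 [h4 e']]] := repr_dirlim_in y.
rewrite /dirlim_add; move: (tagged (repr (dirlim_in x))) (tagged (repr (dirlim_in y))) e e' => x' y' e e'.
move: (ub_index_l _ _) (ub_index_r _ _); set p := ub_index _ _ => hl hr.
pose q := ub_index (ub_index l m) p.
have lq : (l <= q)%O by apply: le_trans (ub_index_l _ _); exact: ub_index_l.
have mq : (m <= q)%O by apply: le_trans (ub_index_l _ _); exact: ub_index_r.
have pq : (p <= q)%O by exact: ub_index_r.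
apply/dirlim_in_eq; exists q, pq, (le_trans h2 lq).
rewrite !raddfD /= (dmap_comp hl pq (le_trans h1 lq)) (dmap_comp hr pq (le_trans h3 mq)).
congr (_ + _); first by rewrite -(dmap_comp h1 lq) e (dmap_comp h2 lq (le_trans h2 lq)).
by rewrite -(dmap_comp h3 mq) e' (dmap_comp h4 mq (le_trans h2 lq)).
Qed.

Lemma dirlim_in2P (z w : dirlim) : exists i (x y : D i), z = dirlim_in x /\ w = dirlim_in y.
Proof.
have [i [x ->]] := dirlim_inP z; have [j [y ->]] := dirlim_inP w.
exists (ub_index i j), (dmap D (ub_index_l i j) x), (dmap D (ub_index_r i j) y).
by rewrite !dirlim_in_map.
Qed.

Lemma dirlim_in3P (z w v : dirlim) : exists i (x y t : D i),
  [/\ z = dirlim_in x, w = dirlim_in y & v = dirlim_in t].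
Proof.
have [i [x [y [-> ->]]]] := dirlim_in2P z w; have [j [t ->]] := dirlim_inP v.
exists (ub_index i j), (dmap D (ub_index_l i j) x), (dmap D (ub_index_l i j) y),
  (dmap D (ub_index_r i j) t).
by rewrite !dirlim_in_map.
Qed.

Lemma dirlim_addA : associative dirlim_add.
Proof.
move=> z w v; have [i [x [y [t [-> -> ->]]]]] := dirlim_in3P z w v.
by rewrite !dirlim_addE addrA.
Qed.
Lemma dirlim_addC : commutative dirlim_add.
Proof.
by move=> z w; have [i [x [y [-> ->]]]] := dirlim_in2P z w; rewrite !dirlim_addE addrC.
Qed.
Lemma dirlim_add0 : left_id dirlim_zero dirlim_add.
Proof.
by move=> z; have [i [x ->]] := dirlim_inP z; rewrite (dirlim_zeroE i) dirlim_addE add0r.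
Qed.
Lemma dirlim_addN : left_inverse dirlim_zero dirlim_opp dirlim_add.
Proof.
move=> z; have [i [x ->]] := dirlim_inP z.
by rewrite (dirlim_zeroE i) dirlim_oppE dirlim_addE addNr.
Qed.

HB.instance Definition _ :=
  GRing.isZmodule.Build dirlim dirlim_addA dirlim_addC dirlim_add0 dirlim_addN.

Lemma dirlim_in_additive i : additive (@dirlim_in i).
Proof.
move=> x y; rewrite -[RHS]/(dirlim_add (dirlim_in x) (dirlim_opp (dirlim_in y))).
by rewrite dirlim_oppE dirlim_addE.
Qed.
HB.instance Definition _ i :=
  GRing.isAdditive.Build _ _ (@dirlim_in i) (@dirlim_in_additive i).

End DirLim.

Definition pow_prod (K : comPzRingType) (A : set K) : set K :=
  [set x | exists2 s : seq (K * nat), (forall p, p \in s -> A p.1) &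
           x = \prod_(p <- s) p.1 ^+ p.2].

Record denom (K : comPzRingType) (A : set K) := Denom {
  denom_val :> K;
  denomP : pow_prod A denom_val }.
HB.instance Definition _ K A := gen_eqMixin (@denom K A).
HB.instance Definition _ K A := gen_choiceMixin (@denom K A).

Section Fractions.
Variables (K : comPzRingType) (A : set K).

Lemma pow_prod1 : pow_prod A 1.
Proof. by exists [::]; rewrite ?big_nil. Qed.
Lemma pow_prodM x y : pow_prod A x -> pow_prod A y -> pow_prod A (x * y).
Proof.
move=> [s sA ->] [t tA ->]; exists (s ++ t); last by rewrite big_cat.
by move=> p; rewrite mem_cat => /orP[/sA|/tA].
Qed.
Lemma pow_prod_mem x : A x -> pow_prod A x.
Proof. by move=> Ax; exists [:: (x, 1%N)]; rewrite ?big_seq1 // => p; rewrite inE => /eqP ->. Qed.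

Definition denom1 : denom A := Denom pow_prod1.
Definition denomM (s t : denom A) : denom A := Denom (pow_prodM (denomP s) (denomP t)).

(* K may have zero divisors, hence the factor u. *)
Definition frac_rel (x y : K * denom A) : bool :=
  `[< exists u : denom A, denom_val u * (x.1 * denom_val y.2 - y.1 * denom_val x.2) = 0 >].

Lemma frac_rel_equiv : equiv_class_of frac_rel.
Proof.
split=> [x|x y|y x z].
- by apply/asboolP; exists denom1; rewrite subrr mulr0.
- by apply/asboolP/asboolP => -[u e]; exists u; rewrite -opprB mulrN e oppr0.
move=> /asboolP[u e] /asboolP[v f]; apply/asboolP.
exists (denomM y.2 (denomM u v)) => /=.
move: (denom_val x.2) (denom_val y.2) (denom_val z.2) (denom_val u) (denom_val v) e f.
move=> x2 y2 z2 u' v' e f; have -> : y2 * (u' * v') * (x.1 * z2 - z.1 * x2) =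
   v' * z2 * (u' * (x.1 * y2 - y.1 * x2)) + u' * x2 * (v' * (y.1 * z2 - z.1 * y2)).
  by ring.
by rewrite e f !mulr0 addr0.
Qed.

Canonical frac_equiv := EquivRelPack frac_rel_equiv.
Canonical frac_enc := defaultEncModRel frac_rel.

Local Open Scope quotient_scope.

Definition fractions := {eq_quot frac_rel}.
HB.instance Definition _ := Choice.on fractions.

Definition mkfrac (a : K) (s : denom A) : fractions := \pi_(fractions) (a, s).

Lemma frac_eq a s b t : mkfrac a s = mkfrac b t <->
  exists u : denom A, denom_val u * (a * denom_val t - b * denom_val s) = 0.
Proof.
rewrite /mkfrac; split; first by move/eqmodP/asboolP.
by move=> h; apply/eqmodP/asboolP.
Qed.

Lemma fracP (z : fractions) : exists a s, z = mkfrac a s.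
Proof. by exists (repr z).1, (repr z).2; rewrite /mkfrac -[LHS]reprK; case: (repr z). Qed.

Definition frac_zero : fractions := mkfrac 0 denom1.
Definition frac_one : fractions := mkfrac 1 denom1.
Definition frac_opp (z : fractions) : fractions := mkfrac (- (repr z).1) (repr z).2.
Definition frac_add (z w : fractions) : fractions :=
  mkfrac ((repr z).1 * denom_val (repr w).2 + (repr w).1 * denom_val (repr z).2)
       (denomM (repr z).2 (repr w).2).
Definition frac_mul (z w : fractions) : fractions := mkfrac ((repr z).1 * (repr w).1) (denomM (repr z).2 (repr w).2).

Lemma repr_frac a s : exists u : denom A,
  denom_val u * ((repr (mkfrac a s)).1 * denom_val s - a * denom_val (repr (mkfrac a s)).2) = 0.
Proof. by apply/frac_eq; rewrite [RHS]/mkfrac -[RHS]reprK /mkfrac; case: (repr _). Qed.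

Lemma frac_oppE a s : frac_opp (mkfrac a s) = mkfrac (- a) s.
Proof.
have [u e] := repr_frac a s; apply/frac_eq; exists u.
by rewrite !mulNr -opprD mulrN e oppr0.
Qed.

Lemma frac_addE a s b t : frac_add (mkfrac a s) (mkfrac b t) =
  mkfrac (a * denom_val t + b * denom_val s) (denomM s t).
Proof.
have [u e] := repr_frac a s; have [v f] := repr_frac b t.
apply/frac_eq; exists (denomM u v) => /=; move: e f.
move: (repr (mkfrac a s)) (repr (mkfrac b t)) => [a' s'] [b' t'] /=.
case: u v s t s' t' => [u ?] [v ?] [s ?] [t ?] [s' ?] [t' ?] /= e f.
transitivity (v * t * t' * (u * (a' * s - a * s')) + u * s * s' * (v * (b' * t - b * t'))).
  by ring.
by rewrite e f !mulr0 addr0.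
Qed.

Lemma frac_mulE a s b t : frac_mul (mkfrac a s) (mkfrac b t) = mkfrac (a * b) (denomM s t).
Proof.
have [u e] := repr_frac a s; have [v f] := repr_frac b t.
apply/frac_eq; exists (denomM u v) => /=; move: e f.
move: (repr (mkfrac a s)) (repr (mkfrac b t)) => [a' s'] [b' t'] /=.
case: u v s t s' t' => [u ?] [v ?] [s ?] [t ?] [s' ?] [t' ?] /= e f.
transitivity (v * t * b' * (u * (a' * s - a * s')) + u * a * s' * (v * (b' * t - b * t'))).
  by ring.
by rewrite e f !mulr0 addr0.
Qed.

Lemma frac_eq1 a s b t : a * denom_val t = b * denom_val s -> mkfrac a s = mkfrac b t.
Proof. by move=> e; apply/frac_eq; exists denom1; rewrite e subrr mulr0. Qed.

Lemma frac_addA : associative frac_add.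
Proof.
move=> x y z; have [a [s ->]] := fracP x; have [b [t ->]] := fracP y; have [c [u ->]] := fracP z.
by rewrite !frac_addE; apply: frac_eq1 => /=; ring.
Qed.
Lemma frac_addC : commutative frac_add.
Proof.
move=> x y; have [a [s ->]] := fracP x; have [b [t ->]] := fracP y.
by rewrite !frac_addE; apply: frac_eq1 => /=; ring.
Qed.
Lemma frac_add0 : left_id frac_zero frac_add.
Proof.
by move=> x; have [a [s ->]] := fracP x; rewrite frac_addE; apply: frac_eq1 => /=; ring.
Qed.
Lemma frac_addN : left_inverse frac_zero frac_opp frac_add.
Proof.
move=> x; have [a [s ->]] := fracP x.
by rewrite frac_oppE frac_addE; apply: frac_eq1 => /=; ring.
Qed.
Lemma frac_mulA : associative frac_mul.
Proof.
move=> x y z; have [a [s ->]] := fracP x; have [b [t ->]] := fracP y; have [c [u ->]] := fracP z.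
by rewrite !frac_mulE; apply: frac_eq1 => /=; ring.
Qed.
Lemma frac_mulC : commutative frac_mul.
Proof.
move=> x y; have [a [s ->]] := fracP x; have [b [t ->]] := fracP y.
by rewrite !frac_mulE; apply: frac_eq1 => /=; ring.
Qed.
Lemma frac_mul1 : left_id frac_one frac_mul.
Proof.
by move=> x; have [a [s ->]] := fracP x; rewrite frac_mulE; apply: frac_eq1 => /=; ring.
Qed.
Lemma frac_mulDl : left_distributive frac_mul frac_add.
Proof.
move=> x y z; have [a [s ->]] := fracP x; have [b [t ->]] := fracP y; have [c [u ->]] := fracP z.
by rewrite !(frac_addE, frac_mulE); apply: frac_eq1 => /=; ring.
Qed.

HB.instance Definition _ :=
  GRing.isZmodule.Build fractions frac_addA frac_addC frac_add0 frac_addN.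
HB.instance Definition _ :=
  GRing.Zmodule_isComPzRing.Build fractions frac_mulA frac_mulC frac_mul1 frac_mulDl.

End Fractions.

Section Proalgebraic.
Variable k : closedFieldType.

(* The transition map pproj (h : i <= j) is pi_ij : X_j -> X_i. *)
Record prosys d (L : preorderType d) := ProSys {
  pobj :> L -> variety k;
  pproj : forall i j, (i <= j)%O -> hom (pobj j) (pobj i);
  pproj_id : forall i (h : (i <= i)%O) x, pproj h x = x;
  pproj_comp : forall i j l (hij : (i <= j)%O) (hjl : (j <= l)%O) (hil : (i <= l)%O) x,
    pproj hij (pproj hjl x) = pproj hil x }.

(* gam i j only matters when i <= j. *)
Record K0sys d (L : preorderType d) := K0Sys {
  gam :> L -> L -> K0 k;
  gam_id : forall i, gam i i = 1;
  gam_comp : forall i j l, (i <= j)%O -> (j <= l)%O -> gam i j * gam j l = gam i l }.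

Section System.
Variables (d : Order.disp_t) (L : preorderType d).

Section Find.
Variable X : prosys L.

Lemma pullback_id i (h : (i <= i)%O) (a : cfun (X i)) : pullback (pproj X h) a = a.
Proof. by apply: cfun_eq => x /=; rewrite pproj_id. Qed.

Lemma pullback_comp i j l (hij : (i <= j)%O) (hjl : (j <= l)%O) (hil : (i <= l)%O)
    (a : cfun (X i)) :
  pullback (pproj X hjl) (pullback (pproj X hij) a) = pullback (pproj X hil) a.
Proof. by apply: cfun_eq => x /=; rewrite (pproj_comp hij hjl hil). Qed.

Definition F_sys : dirsys L :=
  @DirSys d L (fun i => cfun (X i)) (fun i j h => pullback (pproj X h)) pullback_id pullback_comp.

Definition F_ind (dir : directed L) := dirlim dir F_sys.
End Find.

Section Fst.
Variables (X : prosys L) (G : K0sys L).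

Definition stable i (a : cfun (X i)) :=
  forall j (h : (i <= j)%O), Gamma (pullback (pproj X h) a) = G i j * Gamma a.

Definition stableb i : {pred cfun (X i)} := fun a => `[< stable a >].

Lemma stableb_closed i : zmod_closed (@stableb i).
Proof.
split; first by apply/asboolP => j h; rewrite !raddf0 mulr0.
move=> a b /asboolP sa /asboolP sb; apply/asboolP => j h.
by rewrite !raddfB /= mulrBr sa sb.
Qed.
HB.instance Definition _ i :=
  GRing.isZmodClosed.Build _ (@stableb i) (@stableb_closed i).

Record F_st i := FSt {
  F_st_val :> cfun (X i);
  F_st_valP : F_st_val \in @stableb i }.
HB.instance Definition _ i := [isSub for @F_st_val i].
HB.instance Definition _ i := [Choice of F_st i by <:].
HB.instance Definition _ i := [SubChoice_isSubZmodule of F_st i by <:].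

Lemma F_stP i (a : F_st i) : stable a.
Proof. exact/asboolP/F_st_valP. Qed.

Lemma pullback_st_subproof i j (h : (i <= j)%O) (a : F_st i) :
  pullback (pproj X h) a \in @stableb j.
Proof.
apply/asboolP => l hjl; rewrite (pullback_comp h hjl (le_trans h hjl)).
by rewrite !F_stP mulrCA mulrA gam_comp.
Qed.

Definition pullback_st i j (h : (i <= j)%O) (a : F_st i) : F_st j :=
  FSt (pullback_st_subproof h a).

Lemma pullback_st_additive i j (h : (i <= j)%O) : additive (pullback_st h).
Proof. by move=> a b; apply: val_inj; exact: raddfB. Qed.
HB.instance Definition _ i j (h : (i <= j)%O) :=
  GRing.isAdditive.Build _ _ (pullback_st h) (pullback_st_additive h).

Lemma pullback_st_id i (h : (i <= i)%O) (a : F_st i) : pullback_st h a = a.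
Proof. by apply: val_inj; exact: pullback_id. Qed.

Lemma pullback_st_comp i j l (hij : (i <= j)%O) (hjl : (j <= l)%O) (hil : (i <= l)%O)
    (a : F_st i) :
  pullback_st hjl (pullback_st hij a) = pullback_st hil a.
Proof. by apply: val_inj; exact: pullback_comp. Qed.

Definition F_st_sys : dirsys L :=
  @DirSys d L F_st pullback_st pullback_st_id pullback_st_comp.

Definition F_st_ind (dir : directed L) := dirlim dir F_st_sys.
End Fst.

Section K0ind.
Variable G : K0sys L.

Definition gam_mul i j (_ : (i <= j)%O) (r : K0 k) : K0 k := G i j * r.

Lemma gam_mul_additive i j (h : (i <= j)%O) : additive (gam_mul h).
Proof. by move=> r s; rewrite /gam_mul mulrBr. Qed.
HB.instance Definition _ i j (h : (i <= j)%O) :=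
  GRing.isAdditive.Build _ _ (gam_mul h) (gam_mul_additive h).

Lemma gam_mul_id i (h : (i <= i)%O) r : gam_mul h r = r.
Proof. by rewrite /gam_mul gam_id mul1r. Qed.

Lemma gam_mul_comp i j l (hij : (i <= j)%O) (hjl : (j <= l)%O) (hil : (i <= l)%O) r :
  gam_mul hjl (gam_mul hij r) = gam_mul hil r.
Proof. by rewrite /gam_mul mulrCA mulrA gam_comp. Qed.

Definition K0_dirsys : dirsys L :=
  @DirSys d L (fun=> K0 k) gam_mul gam_mul_id gam_mul_comp.

Definition K0_lim (dir : directed L) := dirlim dir K0_dirsys.

Definition gam_elts : set (K0 k) := [set x | exists i j, (i <= j)%O /\ x = G i j].
End K0ind.

End System.

(* p : E -> B is a Zariski locally trivial fiber bundle with fiber F: each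
   point of B has an open neighbourhood ~` Z over which E is isomorphic to
   (~` Z) x F, compatibly with the projections. *)
Definition locally_trivial (E B F : variety k) (p : hom E B) :=
  forall b : B, exists (Z : set B) (Zc : closed Z), ~ Z b /\
    exists (f : hom (sub_variety (preim_lcset p (open_lcset Zc)))
                    (prod_variety (sub_variety (open_lcset Zc)) F))
           (g : hom (prod_variety (sub_variety (open_lcset Zc)) F)
                    (sub_variety (preim_lcset p (open_lcset Zc)))),
      [/\ cancel f g, cancel g f & forall x, sval (f x).1 = p (sval x)].

End Proalgebraic.

Record posn := PosN { posn_val :> nat; posn_gt0 : (0 < posn_val)%N }.
HB.instance Definition _ := [isSub for posn_val].
HB.instance Definition _ := [Choice of posn by <:].
HB.instance Definition _ := [SubChoice_isSubOrder of posn by <: with Order.Disp tt tt].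

Definition psucc (n : nat) : posn := @PosN n.+1 isT.

Lemma posn_directed : directed posn.
Proof.
split=> [|i j]; first by exists (psucc 0).
by have [ij|ji] := leP i j; [exists j | exists i; split => //; exact: ltW].
Qed.

Lemma leq_psucc (n : posn) : (n <= psucc n)%O.
Proof. exact: (leqnSn (posn_val n)). Qed.

Section Sequences.
Variable k : closedFieldType.

(* The terms g_1, g_2, ... of a sequence indexed by the positive integers,
   completed with g_0 := 1 *)
Definition with0 (g : posn -> K0 k) (n : nat) : K0 k :=
  if n is m.+1 then g (psucc m) else 1.

(* gamma_01 gamma_12 ... gamma_(n-1)n with gamma_01 := 1 *)
Definition gam_prod (G : K0sys k posn) (n : posn) : K0 k :=
  \prod_(0 <= i < n) with0 (fun j => G j (psucc j)) i.

Lemma gam_prodP G n : pow_prod (gam_elts G) (gam_prod G n).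
Proof.
rewrite /gam_prod; elim: (posn_val n) => [|m IH]; first by rewrite big_nil; exact: pow_prod1.
rewrite big_nat_recr //=; apply: pow_prodM => //.
case: m {IH} => [|m] /=; first exact: pow_prod1.
by apply: pow_prod_mem; exists (psucc m), (psucc (psucc m)); split => //; exact: leq_psucc.
Qed.

(* gamma_0 gamma_1 ... gamma_(n-1) with gamma_0 := 1 *)
Definition seq_prod (g : posn -> K0 k) (n : posn) : K0 k := \prod_(0 <= i < n) with0 g i.

Lemma seq_prodP g n : pow_prod (range g) (seq_prod g n).
Proof.
rewrite /seq_prod; elim: (posn_val n) => [|m IH]; first by rewrite big_nil; exact: pow_prod1.
rewrite big_nat_recr //=; apply: pow_prodM => //.
case: m {IH} => [|m] /=; first exact: pow_prod1.
by apply: pow_prod_mem; exists (psucc m).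
Qed.

(* gamma_nm = gamma_n gamma_(n+1) ... gamma_(m-1) *)
Definition seq_gam (g : posn -> K0 k) (n m : posn) : K0 k := \prod_(n <= i < m) with0 g i.

Lemma seq_gam_id g n : seq_gam g n n = 1.
Proof. by rewrite /seq_gam big_geq. Qed.
Lemma seq_gam_comp g (n m l : posn) : (n <= m)%O -> (m <= l)%O ->
  seq_gam g n m * seq_gam g m l = seq_gam g n l.
Proof. by move=> nm ml; rewrite /seq_gam [RHS](@big_cat_nat _ _ _ m). Qed.

Definition seq_sys (g : posn -> K0 k) : K0sys k posn :=
  K0Sys (seq_gam_id g) (@seq_gam_comp g).

Lemma gam_prod_seq (g : posn -> K0 k) n : gam_prod (seq_sys g) n = seq_prod g n.
Proof.
rewrite /gam_prod /seq_prod; apply: eq_bigr => -[|m] _ //=.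
by rewrite /seq_gam big_nat1.
Qed.

Lemma gam_prod_seqP (g : posn -> K0 k) n : pow_prod (range g) (gam_prod (seq_sys g) n).
Proof. by rewrite gam_prod_seq; exact: seq_prodP. Qed.

Lemma seq_prod_constP (g : posn -> K0 k) c n : (forall m, g m = c) -> pow_prod (range g) (c ^+ n).
Proof.
move=> gc; exists [:: (c, n)]; last by rewrite big_seq1.
by move=> p; rewrite inE => /eqP -> /=; exists (psucc 0).
Qed.

End Sequences.

Section Classes.
Variables (k : closedFieldType) (d : Order.disp_t) (L : preorderType d) (dir : directed L).

Definition F_in (X : prosys k L) i (a : cfun (X i)) : F_ind X dir :=
  @dirlim_in d L dir (F_sys X) i a.
Definition F_st_in (X : prosys k L) (G : K0sys k L) i (a : F_st X G i) : F_st_ind X G dir :=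
  @dirlim_in d L dir (F_st_sys X G) i a.
Definition K0_in (G : K0sys k L) i (r : K0 k) : K0_lim G dir :=
  @dirlim_in d L dir (K0_dirsys G) i r.

End Classes.

(* The carriers of varieties live in a universe below that of K0, so that K0
   is a ring of the usual kind. The complex numbers are taken to be a fixed
   type, small enough for complex affine spaces to be such carriers. *)
Definition complexes : closedFieldType := Rdefinitions.R[i].

(* Main.v *)
(* A compatible family of homomorphisms induces one on a direct limit, and
   gamma_01 ... gamma_(m-1)m = (gamma_01 ... gamma_(n-1)n) gamma_nm makes division
   by these products compatible with the transition maps. In (iii) a constructible
   function is a combination of characteristic functions of locally closed sets, so
   the hypothesis on constructible sets gives stability under one step, hence under
   all. For a bundle, finitely many trivializing open sets cover the base; cutting a
   locally closed set along their complements leaves pieces over which the total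
   space is a product with the fiber. *)
From HB Require Import structures.
From mathcomp Require Import all_boot all_order all_algebra.
From mathcomp Require Import boolp classical_sets functions cardinality.
From mathcomp Require Import mpoly ring.
Require Import Defs.

Set Implicit Arguments.
Unset Strict Implicit.
Unset Printing Implicit Defensive.

Import Order.TTheory GRing.Theory.
Local Open Scope classical_set_scope.
Local Open Scope ring_scope.

(** * Additive maps out of direct limits *)

(** Universal property of [dirlim]. Evaluating [f] on a chosen representative is well defined
    because two representatives agree at a later index and [f] is compatible with the transition
    maps. *)
Lemma dirlim_lift d (L : preorderType d) (dir : directed L) (D : dirsys L) (A : zmodType)
    (f : forall i, {additive D i -> A}) :
  (forall i j (h : (i <= j)%O) x, f j (dmap D h x) = f i x) ->
  exists F : {additive dirlim dir D -> A}, forall i (x : D i), F (dirlim_in dir x) = f i x.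
Proof.
move=> fD; pose F (z : dirlim dir D) := f _ (tagged (repr z)).
have FE i (x : D i) : F (dirlim_in dir x) = f i x.
  have /dirlim_in_eq[l [h [h' e]]] := repr_dirlim_in dir x.
  by rewrite /F -(fD _ _ h) e fD.
have FB : zmod_morphism F.
  move=> z w; have [i [x [y [-> ->]]]] := dirlim_in2P z w.
  by rewrite -raddfB !FE raddfB.
pose FA := GRing.isZmodMorphism.Build _ _ F FB.
by exists (HB.pack F FA : {additive dirlim dir D -> A}).
Qed.

Lemma mkfracB (K : comPzRingType) (A : set K) (s : denom A) a b :
  mkfrac (a - b) s = mkfrac a s - mkfrac b s.
Proof.
rewrite -[RHS]/(frac_add _ (frac_opp _)) frac_oppE frac_addE.
by apply: frac_eq1 => /=; ring.
Qed.

(** * Quasi-compactness of varieties *)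

HB.instance Definition _ (k : closedFieldType) (X : Type) := gen_eqMixin (chart k X).

Section Compactness.
Variables (k : closedFieldType) (X : variety k) (C : set (set X)).
Hypothesis C_closed : forall Z, C Z -> closed Z.

(* The equations of all members of C follow from finitely many of them, by
   the basis theorem in the coordinates of c. *)
Lemma chart_compact (c : chart k X) : atlas c ->
  exists2 s : seq (set X), (forall Z, Z \in s -> C Z) &
    forall x, cdom c x -> (forall Z, Z \in s -> Z x) -> forall Z, C Z -> Z x.
Proof.
move=> ac.
pose vanish Z (p : {mpoly k[cdim c]}) := forall x, cdom c x -> Z x -> p.@[ccrd c x] = 0.
have [ps psC psP] := hilbert [set p | exists2 Z, C Z & vanish Z p].
have [s sC sP] : exists2 s : seq (set X), (forall Z, Z \in s -> C Z) &
    forall p, p \in ps -> exists2 Z, Z \in s & vanish Z p.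
  elim: ps psC {psP} => [|p ps IH] psC; first by exists [::].
  have [|s sC sP] := IH; first by move=> q qs; apply: psC; rewrite inE qs orbT.
  have [Z CZ pZ] : exists2 Z, C Z & vanish Z p by apply: psC; rewrite inE eqxx.
  exists (Z :: s) => [Z'|q]; first by rewrite inE => /orP[/eqP->|/sC].
  rewrite inE => /orP[/eqP->|/sP[Z' Z's qZ']]; first by exists Z; rewrite ?inE ?eqxx.
  by exists Z'; rewrite // inE Z's orbT.
exists s => // x cx xs Z CZ; apply/(eqsP (C_closed CZ) ac cx) => p pZ.
apply: psP => [q /sP[Z' /xs Z'x]|]; first exact.
by exists Z => // y cy /(eqsP (C_closed CZ) ac cy); exact.
Qed.

(** With the members of [C] read as complements of open sets, this extracts a finite subcover: the
    lists found for the finitely many charts are concatenated. *)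
Lemma variety_compact : (forall x, exists2 Z, C Z & ~ Z x) ->
  exists2 s : seq (set X), (forall Z, Z \in s -> C Z) & forall x, exists2 Z, Z \in s & ~ Z x.
Proof.
move=> C0; have /finite_seqP[cs csE] := atlas_finite X.
have [s sC sP] : exists2 s : seq (set X), (forall Z, Z \in s -> C Z) &
    forall c x, c \in cs -> cdom c x -> exists2 Z, Z \in s & ~ Z x.
  have: forall c, c \in cs -> atlas c by move=> c; rewrite csE.
  elim: (cs) => [|c cs' IH] csa; first by exists [::].
  have [|s sC sP] := IH; first by move=> c' c's; apply: csa; rewrite inE c's orbT.
  have [|t tC tP] := @chart_compact c; first by apply: csa; rewrite inE eqxx.
  exists (t ++ s) => [Z|c' x]; first by rewrite mem_cat => /orP[/tC|/sC].
  rewrite inE => /orP[/eqP-> cx|c's c'x].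
    (* If every set in [t] contained [x], so would every member of [C], in particular [Z]. *)
    have [Z CZ Zx] := C0 x; apply: contrapT => nZ; apply: Zx; apply: (tP x) => // Z' Z't.
    by apply: contrapT => Z'x; apply: nZ; exists Z'; rewrite // mem_cat Z't.
  by have [Z Zs Zx] := sP _ _ c's c'x; exists Z; rewrite // mem_cat Zs orbT.
exists s => // x; have [c ac cx] := atlas_cover x.
by apply: sP cx; move: ac; rewrite csE.
Qed.

End Compactness.

(** * Partitions of constructible sets *)

Section ConstructibleClasses.
Variables (k : closedFieldType) (X : variety k).

Lemma constr_class_lcset (W : lcset X) : constr_class (lcs W) = lc_class W.
Proof.
rewrite (@constr_classE _ _ [:: W]) ?big_seq1 // => x.
by rewrite /= addn0.
Qed.

Lemma constructible_lcset (W : lcset X) : constructible (lcs W).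
Proof.
exists [:: W]; apply/seteqP; split => x /=; first by exists W; rewrite ?inE.
by case=> W'; rewrite inE => /eqP->.
Qed.

(** The closed sets cutting out the pieces of [S] generate finitely many atoms, and an atom meeting
    [S] lies inside it. Hence the atoms contained in [S] partition it. *)
Lemma constructible_partition (S : set X) : constructible S ->
  exists s : seq (lcset X), lc_partition s S.
Proof.
(* The coefficients 1 are placeholders: [lc_eqs] reads the second components. *)
move=> [t tS]; pose t1 := [seq (1 : int, W) | W <- t].
have [s sP sS] := atoms (@lc_eqs_closed _ _ t1).
exists [seq W <- s | `[< lcs W `<=` S >]] => x; rewrite count_filter.
have S_sat W y : W \in s -> lcs W x -> lcs W y -> S x -> S y.
  move=> Ws Wx Wy; rewrite tS => -[V Vt Vx]; exists V => //.
  by apply/(@lc_eqs_sat _ _ t1 (1, V) x y); [exact: map_f|exact: sS Wx Wy|].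
have [/set_mem Sx|/negP Sx] := boolP (x \in S).
  have /= := sP x; rewrite in_setT /= => <-; apply: eq_in_count => W Ws /=.
  rewrite andb_idr // => /set_mem Wx; apply/asboolP => y Wy.
  exact: S_sat Ws Wx Wy Sx.
apply/eqP; rewrite -leqn0 leqNgt -has_count; apply/hasP => -[W Ws] /=.
by move=> /andP[/set_mem Wx /asboolP WS]; apply: Sx; apply/mem_set/WS.
Qed.

End ConstructibleClasses.

(** * Maps whose preimages scale classes by a constant *)

Section Pullback.
Variables (k : closedFieldType) (X Y : variety k) (f : hom X Y) (c : K0 k).

Lemma lc_partition_preim (s : seq (lcset Y)) (S : set Y) : lc_partition s S ->
  lc_partition [seq preim_lcset f W | W <- s] (f @^-1` S).
Proof.
move=> sS x; rewrite count_map.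
rewrite (_ : (x \in f @^-1` S) = (f x \in S)); last by apply/idP/idP => /set_mem/mem_set.
by rewrite -sS; apply: eq_count => W /=; apply/idP/idP => /set_mem/mem_set.
Qed.

Lemma constr_class_preim :
  (forall W : lcset Y, lc_class (preim_lcset f W) = c * lc_class W) ->
  forall S : set Y, constructible S -> constr_class (f @^-1` S) = c * constr_class S.
Proof.
move=> fc S /constructible_partition[s sS].
rewrite (constr_classE sS) (constr_classE (lc_partition_preim sS)) big_map mulr_sumr.
by apply: eq_bigr => W _; exact: fc.
Qed.

(** Pullback replaces each set of a combination by its preimage and keeps the coefficients, so
    [GammaE] allows a comparison term by term. *)
Lemma Gamma_pullback :
  (forall S : set Y, constructible S -> constr_class (f @^-1` S) = c * constr_class S) ->
  forall a : cfun Y, Gamma (pullback f a) = c * Gamma a.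
Proof.
move=> fc a; have [t at'] := cfunP a.
rewrite (GammaE at') (@GammaE _ _ _ [seq (p.1, preim_lcset f p.2) | p <- t]); last first.
  move=> x; rewrite /= at' /comb big_map; apply: eq_bigr => p _ /=.
  by congr (_%:R * _); congr nat_of_bool; apply/idP/idP => /set_mem/mem_set.
rewrite big_map mulr_sumr; apply: eq_bigr => p _ /=.
by rewrite -!constr_class_lcset mulrzAr -fc //; exact: constructible_lcset.
Qed.

End Pullback.

(** * Zariski locally trivial bundles *)

Section Bundle.
Variables (k : closedFieldType) (E B F : variety k) (p : hom E B).

(** The part of [locally_trivial] that mentions no point, so that it defines a family of closed sets
    to which [variety_compact] applies. *)
Definition trivial_off (Z : set B) := exists Zc : closed Z,
  exists (f : hom (sub_variety (preim_lcset p (open_lcset Zc)))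
                  (prod_variety (sub_variety (open_lcset Zc)) F))
         (g : hom (prod_variety (sub_variety (open_lcset Zc)) F)
                  (sub_variety (preim_lcset p (open_lcset Zc)))),
    [/\ cancel f g, cancel g f & forall x, sval (f x).1 = p (sval x)].

(** The trivialization over the complement of [Z] restricts to an isomorphism from the preimage of
    [W] onto the product of [W] and [F]. *)
Lemma trivial_off_class (Z : set B) (W : lcset B) : trivial_off Z -> lcs W `<=` ~` Z ->
  lc_class (preim_lcset p W) = K0_class F * lc_class W.
Proof.
move=> [Zc [f [g [fg gf fp]]]] WZ.
have gp y : p (sval (g y)) = sval y.1 by rewrite -fp gf.
pose U := open_lcset Zc.
have hU (x : sub_variety (preim_lcset p W)) : lcs (preim_lcset p U) (hom_sub _ x).
  by apply: WZ; exact: (svalP x).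
have hW (x : sub_variety (preim_lcset p W)) : lcs W (hom_comp p (hom_sub _) x).
  exact: (svalP x).
pose f' := hom_pair (hom_corestr hW) (hom_comp (hom_snd _ _) (hom_comp f (hom_corestr hU))).
have kU (w : sub_variety W) : lcs U (hom_sub _ w) by apply: WZ; exact: (svalP w).
pose j := hom_pair (hom_comp (hom_corestr kU) (hom_fst _ F)) (hom_snd (sub_variety W) F).
have kW (y : prod_variety (sub_variety W) F) :
    lcs (preim_lcset p W) (hom_comp (hom_sub _) (hom_comp g j) y).
  by rewrite /= /preimage /= gp /=; exact: (svalP y.1).
rewrite /lc_class mulrC [RHS]K0_mulE; apply: K0_iso.
exists f', (hom_corestr kW); split => [x|[w z]].
  apply: sub_hom_eq => /=; set y := (X in g X).
  (* [y] pairs [p x] with the fiber coordinate of [f x]; as the first component of [f] is [p], this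
     is [f x]. *)
  suff -> : y = f (hom_corestr hU x) by rewrite fg.
  rewrite /y [RHS]surjective_pairing; congr pair; apply: (@sub_hom_eq _ _ U) => /=.
  by rewrite fp.
congr pair; first by apply: sub_hom_eq; rewrite /= gp.
rewrite -[LHS]/(f (hom_corestr hU (hom_corestr kW (w, z)))).2.
have -> : hom_corestr hU (hom_corestr kW (w, z)) = g (j (w, z)).
  exact: (@sub_hom_eq _ _ (preim_lcset p U)).
by rewrite gf.
Qed.

(** Induction on a finite list of closed sets whose complements cover [W]: the part of [W] off [Z]
    lies over a trivializing open set, and the part in [Z] is covered by the rest. *)
Lemma locally_trivial_class (W : lcset B) : locally_trivial F p ->
  lc_class (preim_lcset p W) = K0_class F * lc_class W.
Proof.
move=> triv; have [Z [Zc _]|x|s sT sP] := @variety_compact _ B [set Z | trivial_off Z].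
- exact: Zc.
- by have [Z [Zc [Zx fg]]] := triv x; exists Z => //; exists Zc.
(* Asking for a cover of [W] alone lets the induction hypothesis apply to [W] cut by [Z]. *)
have {}sP x : lcs W x -> exists2 Z, Z \in s & ~ Z x by move=> _; exact: sP.
elim: s W sT sP => [|Z s IH] W sT sP.
  have W0 x : ~ lcs W x by move=> /sP[].
  have e0 V (A : lcset V) : (forall x, ~ lcs A x) -> lc_class A = 0.
    by move=> A0; apply: lc_class0; apply/seteqP; split => x // /A0.
  by rewrite !e0 ?mulr0 // => x; exact: W0.
have TZ : trivial_off Z by apply: sT; rewrite inE eqxx.
have [Zc _] := TZ.
have pE (V : lcset B) : lcsetI (preim_lcset p W) (preim_lcset p V) = preim_lcset p (lcsetI W V).
  exact: lcset_eq.
rewrite (lc_cut W Zc) mulrDr (lc_cut _ (hom_closed p Zc)); congr (_ + _).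
  rewrite (_ : closed_lcset _ = preim_lcset p (closed_lcset Zc)) ?pE; last exact: lcset_eq.
  apply: IH => [Z' Z's|x [/sP[Z' + Z'x] Zx]]; first by apply: sT; rewrite inE Z's orbT.
  by rewrite inE => /orP[/eqP Z'Z|]; [move: Z'x; rewrite Z'Z|exists Z'].
rewrite (_ : open_lcset _ = preim_lcset p (open_lcset Zc)) ?pE; last exact: lcset_eq.
by apply: trivial_off_class TZ _ => x [].
Qed.

End Bundle.

(** * Induced homomorphisms on inductive limits *)

Section Limits.
Variables (k : closedFieldType) (d : Order.disp_t) (L : preorderType d) (dir : directed L).
Variables (X : prosys k L) (G : K0sys k L).

Lemma K0_in_gam i j (h : (i <= j)%O) (r : K0 k) : K0_in dir G j (G i j * r) = K0_in dir G i r.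
Proof. exact: (@dirlim_in_map _ _ dir (K0_dirsys G) _ _ h). Qed.

(** Stability says exactly that [Gamma] commutes with the transition maps. *)
Lemma Gamma_st_ind : exists Gamma_ind : {additive F_st_ind X G dir -> K0_lim G dir},
  forall i (a : F_st X G i), Gamma_ind (F_st_in dir a) = K0_in dir G i (Gamma a).
Proof.
pose f i : {additive F_st X G i -> K0_lim G dir} :=
  @dirlim_in _ _ dir (K0_dirsys G) i \o (@Gamma k (X i) \o val).
have [i j h a|F FE] := @dirlim_lift _ _ dir (F_st_sys X G) _ f.
  by rewrite /= F_stP; exact: K0_in_gam.
by exists F => i a; exact: FE.
Qed.

Lemma Gamma_ind_stable : (forall i (a : cfun (X i)), stable G a) ->
  exists Gamma_ind : {additive F_ind X dir -> K0_lim G dir},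
    forall i (a : cfun (X i)), Gamma_ind (F_in dir a) = K0_in dir G i (Gamma a).
Proof.
move=> st; pose f i : {additive cfun (X i) -> K0_lim G dir} :=
  @dirlim_in _ _ dir (K0_dirsys G) i \o @Gamma k (X i).
have [i j h a|F FE] := @dirlim_lift _ _ dir (F_sys X) _ f.
  by rewrite /= st; exact: K0_in_gam.
by exists F => i a; exact: FE.
Qed.

(** Passing from [i] to [j] multiplies numerator and denominator by the same [G i j], so the
    fraction is unchanged. *)
Lemma K0_lim_fractions (A : set (K0 k)) (s : L -> denom A) :
  (forall i j, (i <= j)%O -> denom_val (s j) = denom_val (s i) * G i j) ->
  exists theta : {additive K0_lim G dir -> fractions A},
    forall i r, theta (K0_in dir G i r) = mkfrac r (s i).
Proof.
move=> sG; pose fA i := GRing.isZmodMorphism.Build _ _ (fun r => mkfrac r (s i)) (@mkfracB _ _ (s i)).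
pose f i : {additive K0 k -> fractions A} := HB.pack (fun r => mkfrac r (s i)) (fA i).
have [i j h r|F FE] := @dirlim_lift _ _ dir (K0_dirsys G) _ f.
  by apply: frac_eq1; rewrite /= /gam_mul (sG _ _ h); ring.
by exists F => i r; exact: FE.
Qed.

End Limits.

(** * Systems indexed by the positive integers *)

Section Sequences.
Variables (k : closedFieldType).

Lemma posn_le_ind (n : posn) (P : posn -> Prop) : P n ->
  (forall m : posn, (n <= m)%O -> P m -> P (psucc m)) ->
  forall m : posn, (n <= m)%O -> P m.
Proof.
move=> P0 PS [m m0]; elim: m m0 => [//|m IH] m0.
rewrite -[(n <= _)%O]/(n <= m.+1)%N leq_eqVlt => /orP[/eqP e|nm].
  by have <- : n = PosN m0 by exact: val_inj.
have m1 : (0 < m)%N by exact: leq_trans (posn_gt0 n) nm.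
have -> : PosN m0 = psucc (PosN m1) by exact: val_inj.
by apply: PS => //; exact: IH.
Qed.

(** The factor of index 0 is 1, which leaves one copy of [c] fewer than there are factors. *)
Lemma seq_prod_const (g : posn -> K0 k) c (n : posn) : (forall m, g m = c) ->
  seq_prod g n = c ^+ n.-1.
Proof.
move=> gc; case: n => -[//|n] n0; rewrite /seq_prod /= big_nat_recl //= mul1r.
under eq_bigr => i _ do rewrite gc.
by rewrite big_const_nat subn0 iter_mulr_1.
Qed.

(** This is the compatibility that [K0_lim_fractions] asks of the denominators. *)
Lemma gam_prod_gam (G : K0sys k posn) (n m : posn) : (n <= m)%O ->
  gam_prod G m = gam_prod G n * G n m.
Proof.
move: m; apply: posn_le_ind => [|m nm IH]; first by rewrite gam_id mulr1.
rewrite -(gam_comp G nm (leq_psucc m)) mulrA -IH /gam_prod /= big_nat_recr //=.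
(* [with0] returns [psucc] of the predecessor, which equals the index only up to its proof of
   positivity. *)
case: m {nm IH} => -[//|m] m0 /=; congr (_ * G _ _); exact: val_inj.
Qed.

Variables (X : prosys k posn) (g : posn -> K0 k).
Hypothesis Xg : forall (n : posn) (S : set (X n)), constructible S ->
  constr_class (pproj X (leq_psucc n) @^-1` S) = g n * constr_class S.

(* The induction over m quantifies over the proof of n <= m, on which the
   transition map formally depends. *)
Lemma seq_stable n (a : cfun (X n)) : stable (seq_sys g) a.
Proof.
suff st m : (n <= m)%O -> forall h : (n <= m)%O,
    Gamma (pullback (pproj X h) a) = seq_gam g n m * Gamma a.
  by move=> m h; exact: st.
move: m; apply: posn_le_ind => [h|m nm IH h]; first by rewrite pullback_id seq_gam_id mul1r.
rewrite -(pullback_comp nm (leq_psucc m) h) (Gamma_pullback (@Xg m)) IH.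
rewrite -(seq_gam_comp g nm (leq_psucc m)) mulrA; congr (_ * _).
rewrite mulrC {3}/seq_gam big_nat1 /=.
by case: m {nm IH h} => -[//|m] m0 /=; congr (_ * g _); exact: val_inj.
Qed.

(** Fixing only the values of the denominators [s] serves both (iii) and (iv), which write the same
    element as a product and as a power. *)
Lemma Gamma_fractions (s : posn -> denom (range g)) :
  (forall n, denom_val (s n) = seq_prod g n) ->
  exists (Gamma_ind : {additive F_ind X posn_directed -> K0_lim (seq_sys g) posn_directed})
         (theta : {additive K0_lim (seq_sys g) posn_directed -> fractions (range g)})
         (Gamma_can : {additive F_ind X posn_directed -> fractions (range g)}),
    [/\ forall (n : posn) (a : cfun (X n)),
          Gamma_ind (F_in posn_directed a) = K0_in posn_directed (seq_sys g) n (Gamma a),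
        forall (n : posn) (r : K0 k),
          theta (K0_in posn_directed (seq_sys g) n r) = mkfrac r (Denom (gam_prod_seqP g n)),
        forall z, Gamma_can z = theta (Gamma_ind z) &
        forall (n : posn) (a : cfun (X n)),
          Gamma_can (F_in posn_directed a) = mkfrac (Gamma a) (s n)].
Proof.
move=> sE; have [Gi GiE] := Gamma_ind_stable posn_directed seq_stable.
have [theta thE] := @K0_lim_fractions _ _ _ posn_directed (seq_sys g) _
  (fun n => Denom (gam_prod_seqP g n)) (@gam_prod_gam (seq_sys g)).
exists Gi, theta, (theta \o Gi); split => // n a.
(* The two denominators are equal in [K0] but carry different membership proofs, so the fractions
   are compared by cross-multiplication. *)
by rewrite /= GiE thE; apply: frac_eq1; rewrite /= sE gam_prod_seq.
Qed.

End Sequences.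

Theorem theorem1p2 :
  (* (i) *)
  (forall (d : Order.disp_t) (L : preorderType d) (dir : directed L)
      (X : prosys complexes L) (G : K0sys complexes L),
    (forall i j : L, (i < j)%O -> G i j != 0) ->
    exists Gamma_ind : {additive F_st_ind X G dir -> K0_lim G dir},
      forall (i : L) (a : F_st X G i),
        Gamma_ind (F_st_in dir a) = K0_in dir G i (Gamma a))
  /\
  (* (ii) *)
  (forall (X : prosys complexes posn) (G : K0sys complexes posn),
    (forall n m : posn, (n < m)%O -> G n m != 0) ->
    exists (Gamma_ind : {additive F_st_ind X G posn_directed -> K0_lim G posn_directed})
           (theta : {additive K0_lim G posn_directed -> fractions (gam_elts G)})
           (Gamma_tilde : {additive F_st_ind X G posn_directed -> fractions (gam_elts G)}),
      [/\ forall (n : posn) (a : F_st X G n),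
            Gamma_ind (F_st_in posn_directed a) = K0_in posn_directed G n (Gamma a),
          forall (n : posn) (r : K0 complexes),
            theta (K0_in posn_directed G n r) = mkfrac r (Denom (gam_prodP G n)),
          forall z, Gamma_tilde z = theta (Gamma_ind z) &
          forall (n : posn) (a : F_st X G n),
            Gamma_tilde (F_st_in posn_directed a) =
              mkfrac (Gamma a) (Denom (gam_prodP G n))])
  /\
  (* (iii) *)
  (forall (X : prosys complexes posn) (g : posn -> K0 complexes),
    (forall (n : posn) (S : set (X n)), constructible S ->
       constr_class (pproj X (leq_psucc n) @^-1` S) = g n * constr_class S) ->
    (forall (n : posn) (a : cfun (X n)), stable (seq_sys g) a) /\
    exists (Gamma_ind : {additive F_ind X posn_directed -> K0_lim (seq_sys g) posn_directed})
           (theta : {additive K0_lim (seq_sys g) posn_directed -> fractions (range g)})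
           (Gamma_can : {additive F_ind X posn_directed -> fractions (range g)}),
      [/\ forall (n : posn) (a : cfun (X n)),
            Gamma_ind (F_in posn_directed a) = K0_in posn_directed (seq_sys g) n (Gamma a),
          forall (n : posn) (r : K0 complexes),
            theta (K0_in posn_directed (seq_sys g) n r) = mkfrac r (Denom (gam_prod_seqP g n)),
          forall z, Gamma_can z = theta (Gamma_ind z) &
          forall (n : posn) (a : cfun (X n)),
            Gamma_can (F_in posn_directed a) = mkfrac (Gamma a) (Denom (seq_prodP g n))])
  /\
  (* (iii), example: Zariski locally trivial fiber bundles *)
  (forall (X : prosys complexes posn) (n : posn) (F : variety complexes),
    locally_trivial F (pproj X (leq_psucc n)) ->
    forall S : set (X n), constructible S ->
      constr_class (pproj X (leq_psucc n) @^-1` S) = K0_class F * constr_class S)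
  /\
  (* (iv) *)
  (forall (X : prosys complexes posn) (g : posn -> K0 complexes) (c : K0 complexes)
      (gc : forall n : posn, g n = c),
    (forall (n : posn) (S : set (X n)), constructible S ->
       constr_class (pproj X (leq_psucc n) @^-1` S) = g n * constr_class S) ->
    exists (Gamma_ind : {additive F_ind X posn_directed -> K0_lim (seq_sys g) posn_directed})
           (theta : {additive K0_lim (seq_sys g) posn_directed -> fractions (range g)})
           (Gamma_can : {additive F_ind X posn_directed -> fractions (range g)}),
      [/\ forall (n : posn) (a : cfun (X n)),
            Gamma_ind (F_in posn_directed a) = K0_in posn_directed (seq_sys g) n (Gamma a),
          forall (n : posn) (r : K0 complexes),
            theta (K0_in posn_directed (seq_sys g) n r) = mkfrac r (Denom (gam_prod_seqP g n)),
          forall z, Gamma_can z = theta (Gamma_ind z) &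
          forall (n : posn) (a : cfun (X n)),
            Gamma_can (F_in posn_directed a) =
              mkfrac (Gamma a) (Denom (seq_prod_constP n.-1 gc))]).
Proof.
split; first by move=> d L dir X G _; exact: Gamma_st_ind.
split.
  move=> X G _; have [Gi GiE] := Gamma_st_ind posn_directed X G.
  have [theta thE] := @K0_lim_fractions _ _ _ posn_directed G _
    (fun n => Denom (gam_prodP G n)) (gam_prod_gam G).
  exists Gi, theta, (theta \o Gi); split => // n a.
  by rewrite /= GiE thE.
split.
  move=> X g Xg; split; first exact: seq_stable.
  exact: (Gamma_fractions Xg (s := fun n => Denom (seq_prodP g n))).
split.
  (* A partition reduces constructible sets to locally closed ones. *)
  move=> X n F triv; apply: constr_class_preim => W; exact: locally_trivial_class.
move=> X g c gc Xg.
apply: (Gamma_fractions Xg (s := fun n => Denom (seq_prod_constP n.-1 gc))) => n.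
exact/esym/seq_prod_const.
Qed.
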